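(* Let $Y$ be a quasi-reflexive Banach space, let $k\in\mathbb N$, let $a=(a_1,\dots,a_k)$ be a sequence of non-zero real numbers, let $\mathbb M$ be an infinite subset of $\mathbb N$ and let $f:(G_k(\mathbb M),d_a)\to Y^{**}$ be a Lipschitz map. Then for every $\varepsilon>0$ there exists an infinite subset $\mathbb M'$ of $\mathbb M$ such that $$\forall(\overline n,\overline m)\in I_k(\mathbb M'),\qquad \|f(\overline n)-f(\overline m)\|\le 2e\,\mathrm{Lip}(f)\,\|a\|_{\overline{\rho}_Y}+\varepsilon.$$
   Context: A Banach space $Y$ is quasi-reflexive if the image of its canonical embedding into $Y^{**}$ has finite codimension in $Y^{**}$. For a Banach space $Y$ with unit sphere $S_Y$, $t\in[0,\infty)$, $y\in S_Y$ and $Z$ a closed linear subspace of $Y$, put $\overline{\rho}_Y(t,y,Z)=\sup_{z\in S_Z}(\|y+tz\|-1)$ (with value $0$ if $Z=\{0\}$), $\overline{\rho}_Y(t,y)=\inf_{\dim(Y/Z)<\infty}\overline{\rho}_Y(t,y,Z)$ and $\overline{\rho}_Y(t)=\sup_{y\in S_Y}\overline{\rho}_Y(t,y)$. The function $\overline{\rho}_Y$ is used as an Orlicz function: for a real sequence $x=(x_n)_{n\ge1}$, $\|x\|_{\overline{\rho}_Y}=\inf\{r>0:\ \sum_{n=1}^\infty\overline{\rho}_Y(|x_n|/r)\le1\}$. A finite sequence $a=(a_1,\dots,a_k)$ is identified with the sequence $(a_1,\dots,a_k,0,0,\dots)$. For an infinite subset $\mathbb M$ of $\mathbb N$ and $k\in\mathbb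 N$, $G_k(\mathbb M)=\{\overline n=(n_1,\dots,n_k):\ n_i\in\mathbb M,\ n_1<\dots<n_k\}$, equipped here with the distance $d_a(\overline n,\overline m)=\sum_{j:\,n_j\ne m_j}|a_j|$. The set of strictly interlaced pairs is $I_k(\mathbb M)=\{(\overline n,\overline m)\in G_k(\mathbb M)\times G_k(\mathbb M):\ n_1<m_1<n_2<m_2<\dots<n_k<m_k\}$. $\mathrm{Lip}(f)$ denotes the best Lipschitz constant of $f$ with respect to $d_a$. $e$ is the base of the natural logarithm. *)

(* Defs.v *)
From HB Require Import structures.
From mathcomp Require Import all_boot all_order all_algebra.
From mathcomp Require Import all_classical all_reals all_analysis.

Set Implicit Arguments.
Unset Strict Implicit.
Unset Printing Implicit Defensive.

Import Order.TTheory GRing.Theory Num.Theory.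
Import numFieldNormedType.Exports.

Local Open Scope classical_set_scope.
Local Open Scope ring_scope.

(* The topological dual of a real normed space, with the operator norm. *)
Section Dual.
Context (R : realType) (V : normedModType R).

Definition is_functional : {pred V -> R^o} :=
  fun phi => `[< linear phi /\ continuous phi >].

Lemma is_functional_submod : submod_closed is_functional.
Proof.
split=> [|c phi psi /asboolP[lphi cphi] /asboolP[lpsi cpsi]]; apply/asboolP.
  split=> [a x y|x]; first by rewrite scaler0 addr0.
  exact: cst_continuous.
split=> [a x y|x].
  rewrite !fctE lphi lpsi !scalerDr !scalerA (mulrC c a) addrACA.
  by rewrite -!scalerA.
apply: cvgD; last exact: cpsi.
by apply: cvgZl_tmp; exact: cphi.
Qed.

HB.instance Definition _ :=
  GRing.isSubmodClosed.Build R (V -> R^o) is_functional is_functional_submod.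

Record dual := Dual {
  dual_val :> V -> R^o;
  dual_valP : dual_val \in is_functional }.

HB.instance Definition _ := [isSub for dual_val].
HB.instance Definition _ := [Choice of dual by <:].
HB.instance Definition _ := [SubChoice_isSubLmodule of dual by <:].

Definition dual_norm (phi : dual) : R :=
  sup [set `|phi x| | x in [set x : V | `|x| <= 1]].

Lemma dual_linear (phi : dual) : linear phi.
Proof. by have /asboolP[] := dual_valP phi. Qed.

Lemma dual_continuous (phi : dual) : continuous phi.
Proof. by have /asboolP[] := dual_valP phi. Qed.

HB.instance Definition _ (phi : dual) :=
  GRing.isLinear.Build R V R^o _ phi (dual_linear phi).

Lemma dualDE (phi psi : dual) x : (phi + psi) x = phi x + psi x.
Proof. by []. Qed.

Lemma dualZE (a : R) (phi : dual) x : (a *: phi) x = a * phi x.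
Proof. by []. Qed.

Lemma dual_ext (phi psi : dual) : phi =1 psi -> phi = psi.
Proof. by move=> e; apply: val_inj; apply/funext. Qed.

Lemma dual_norm_has_sup (phi : dual) :
  has_sup [set `|phi x| | x in [set x : V | `|x| <= 1]].
Proof.
split; first by exists `|phi 0|, 0 => //=; rewrite normr0.
have [_ /(_ (@dual_continuous phi))] :=
  @linear_bounded_continuous R V R^o phi.
move=> /(@bounded_funP R V R^o phi)/(_ 1)[M phiM].
by exists M => _ [x /= x1 <-]; exact: phiM.
Qed.

Lemma dual_norm_ub (phi : dual) x : `|x| <= 1 -> `|phi x| <= dual_norm phi.
Proof.
by move=> x1; apply: (sup_upper_bound (dual_norm_has_sup phi)); exists x.
Qed.

Lemma dual_norm_le (phi : dual) M :
  (forall x, `|x| <= 1 -> `|phi x| <= M) -> dual_norm phi <= M.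
Proof.
move=> phiM; apply: sup_le_ub; first by have [] := dual_norm_has_sup phi.
by move=> _ [x /= x1 <-]; exact: phiM.
Qed.

Lemma dual_norm_ge0 (phi : dual) : 0 <= dual_norm phi.
Proof.
by apply: le_trans (dual_norm_ub phi (x := 0) _); rewrite ?normr0 ?normr_ge0.
Qed.

Lemma dual_norm_mul (phi : dual) x : `|phi x| <= dual_norm phi * `|x|.
Proof.
have [->|x0] := eqVneq x 0; first by rewrite linear0 !normr0 mulr0.
have x_gt0 : 0 < `|x| by rewrite normr_gt0.
rewrite -ler_pdivrMr// mulrC.
have -> : `|x|^-1 * `|phi x| = `|phi (`|x|^-1 *: x)|.
  by rewrite linearZ/= normrZ gtr0_norm// invr_gt0.
by apply: dual_norm_ub; rewrite normrZ gtr0_norm ?invr_gt0// mulVf// gt_eqF.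
Qed.

Lemma dual_normD (phi psi : dual) :
  dual_norm (phi + psi) <= dual_norm phi + dual_norm psi.
Proof.
apply: dual_norm_le => x x1.
by rewrite (le_trans (ler_normD _ _))// lerD// dual_norm_ub.
Qed.

Lemma dual_normZ (a : R) (phi : dual) :
  dual_norm (a *: phi) = `|a| * dual_norm phi.
Proof.
have leZ b (psi : dual) : dual_norm (b *: psi) <= `|b| * dual_norm psi.
  apply: dual_norm_le => x x1; rewrite dualZE normrM.
  by rewrite ler_wpM2l// dual_norm_ub.
apply/le_anti; rewrite leZ/=.
have [->|a0] := eqVneq a 0; first by rewrite normr0 mul0r dual_norm_ge0.
rewrite -ler_pdivlMl ?normr_gt0// -normfV.
by rewrite -{1}(scale1r phi) -(mulVf a0) -scalerA leZ.
Qed.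

Lemma dual_norm0_eq0 (phi : dual) : dual_norm phi = 0 -> phi = 0.
Proof.
move=> phi0; apply: dual_ext => x.
by apply/eqP; rewrite -normr_le0 (le_trans (dual_norm_mul _ _))// phi0 mul0r.
Qed.

HB.instance Definition _ :=
  Lmodule_isNormed.Build R dual dual_normD dual_normZ dual_norm0_eq0.

Lemma dual_normE (phi : dual) : `|phi| = dual_norm phi.
Proof. by []. Qed.

End Dual.

Notation bidual Y := (dual (dual Y)).

Section CanonicalEmbedding.
Context (R : realType) (V : normedModType R).

Lemma canonical_embedding_subproof (x : V) :
  (fun phi : dual V => phi x) \in @is_functional R (dual V).
Proof.
apply/asboolP; have lin : linear (fun phi : dual V => phi x) by [].
split=> //.
pose ev : {linear dual V -> R^o} :=
  HB.pack (fun phi : dual V => phi x) (GRing.isLinear.Build R _ _ _ _ lin).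
have [+ _] := @linear_bounded_continuous R (dual V) R^o ev; apply.
apply/(@bounded_funP R (dual V) R^o ev) => r; exists (r * `|x|) => phi phir.
by rewrite (le_trans (dual_norm_mul _ _))// ler_wpM2r.
Qed.

Definition canonical_embedding (x : V) : bidual V :=
  Dual (canonical_embedding_subproof x).

End CanonicalEmbedding.

(* dim (V / Z) < oo: the classes of finitely many vectors span V / Z. *)
Definition finite_codim (R : realType) (V : lmodType R) (Z : set V) : Prop :=
  exists (n : nat) (b : 'I_n -> V),
    forall v : V, exists c : 'I_n -> R, Z (v - \sum_(i < n) c i *: b i).

Definition quasi_reflexive (R : realType) (Y : normedModType R) : Prop :=
  finite_codim (range (@canonical_embedding R Y)).

Section AsymptoticSmoothness.
Context (R : realType) (Y : normedModType R).

(* When Z = {0} the set is empty, and sup set0 = 0 by convention; otherwise,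
   for `|y| = 1 and t >= 0, it is nonempty and bounded above by t. *)
Definition rho_bar_at (t : R) (y : Y) (Z : set Y) : R :=
  sup [set `|y + t *: z| - 1 | z in [set z | Z z /\ `|z| = 1]].

Definition rho_bar_pt (t : R) (y : Y) : R :=
  inf [set rho_bar_at t y Z | Z in
    [set Z : set Y | [/\ closed Z, submod_closed (mem Z) & finite_codim Z]]].

(* The value is 0, again as sup set0, when Y = {0}. *)
Definition rho_bar (t : R) : R :=
  sup [set rho_bar_pt t y | y in [set y : Y | `|y| = 1]].

End AsymptoticSmoothness.

(* Sequences are indexed from 0; the norm is +oo outside the Orlicz space. *)
Definition orlicz_norm (R : realType) (rho : R -> R) (x : R^nat) : \bar R :=
  ereal_inf [set r%:E | r in [set r : R | 0 < r /\
    (\sum_(0 <= n <oo) (rho (`|x n| / r))%:E <= 1)%E]].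

Definition zero_extension (R : realType) (k : nat) (a : k.-tuple R) : R^nat :=
  nth 0 a.

Section InterlacingGraph.
Context (k : nat).

Definition Gk (M : set nat) : set (k.-tuple nat) :=
  [set n : k.-tuple nat | sorted ltn n /\ forall i, M (tnth n i)].

Definition Ik (M : set nat) : set (k.-tuple nat * k.-tuple nat) :=
  [set nm | [/\ Gk M nm.1, Gk M nm.2,
    forall i, (tnth nm.1 i < tnth nm.2 i)%N &
    forall i j : 'I_k, j = i.+1 :> nat -> (tnth nm.2 i < tnth nm.1 j)%N]].

Definition dist_a (R : realType) (a : k.-tuple R) (n m : k.-tuple nat) : R :=
  \sum_(j < k | tnth n j != tnth m j) `|tnth a j|.

End InterlacingGraph.

Section Lipschitz.
Context (R : realType) (T : Type) (A : set T) (d : T -> T -> R).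
Context (W : normedModType R) (f : T -> W).

Definition lipschitz_constants : set R :=
  [set L | 0 <= L /\ forall s t, A s -> A t -> `|f s - f t| <= L * d s t].

Definition is_lipschitz : Prop := lipschitz_constants !=set0.

Definition Lip : R := inf lipschitz_constants.

End Lipschitz.

(* Main.v *)
(* Fix a free ultrafilter U on M.  Bounded sequences of Y** have weak* limits along U, so f has
   iterated weak* limits F_j(n_1, ..., n_j), and f(n) - f(m) is the sum of the increments
   z_j(n) - z_j(m), where z_j = F_j - F_{j-1} is weak* null in its last variable and has norm at
   most Lip(f) |a_j|.  Since Y has finite codimension in Y**, finitely many functionals on Y**
   control the distance to Y; their iterated limits along U do not depend on the tuple, so all
   the partial sums stay close to Y when n_1, m_1, n_2, m_2, ... are chosen successively in sets
   of U.  For u in Y with |u| <= r and w weak* null with |w| <= t, the norm of u + w is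
   asymptotically at most r (1 + rho(t / r)).  Applied k times with t = 2 Lip(f) |a_j|, starting
   from u = 0 and r = 2 Lip(f) s with s close to the Orlicz norm of a, this gives at most
   r prod_j (1 + rho(|a_j| / s)) <= e r.  A diagonal argument turns the successive choices in
   sets of U into an infinite set M'. *)
Require Import Defs.
From HB Require Import structures.
From mathcomp Require Import all_boot all_order all_algebra.
From mathcomp Require Import all_classical all_reals all_analysis.
From mathcomp Require Import ring lra.

Import Order.TTheory GRing.Theory Num.Theory.
Import numFieldNormedType.Exports.

Local Open Scope classical_set_scope.
Local Open Scope ring_scope.

Set Implicit Arguments.
Unset Strict Implicit.
Unset Printing Implicit Defensive.

(** * The Hahn-Banach theorem *)

Section HahnBanach.
Context (R : realType) (V : normedModType R).

Lemma dual_intro (g : V -> R) (C : R) :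
  (forall c x y, g (c *: x + y) = c * g x + g y) ->
  (forall x, `|g x| <= C * `|x|) ->
  exists phi : dual V, phi =1 g.
Proof.
move=> glin gC.
have lin : linear (g : V -> R^o) by [].
pose G : {linear V -> R^o} := HB.pack (g : V -> R^o) (GRing.isLinear.Build R V R^o _ g lin).
have cG : continuous G.
  have [+ _] := @linear_bounded_continuous R V R^o G; apply.
  apply/(@bounded_funP R V R^o G) => r; exists (`|C| * r) => x xr.
  by rewrite (le_trans (gC x))// (le_trans (ler_wpM2r _ (ler_norm C)))// ler_wpM2l.
have mem_g : (g : V -> R^o) \in @is_functional R V by apply/asboolP; split.
by exists (Dual mem_g).
Qed.

Implicit Types (M : R) (G : set (V * R)).

(* Partial functionals are represented by their graphs. *)
Record dominated_graph (M : R) (G : set (V * R)) : Prop := DominatedGraph {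
  dominated_graph0 : G (0, 0);
  dominated_graphP : forall (c : R) x a y b,
    G (x, a) -> G (y, b) -> G (c *: x + y, c * a + b);
  dominated_graph_le : forall x a, G (x, a) -> a <= M * `|x| }.

(** Subtracting the two pairs puts [(0, b - a)] in the graph, and domination at the vector [0] makes
    its second entry nonpositive; exchanging the roles gives equality. *)
Lemma dominated_graph_fun M G x a b :
  dominated_graph M G -> G (x, a) -> G (x, b) -> a = b.
Proof.
move=> [G0 GP Gle].
suff le_ab c d : G (x, c) -> G (x, d) -> c <= d.
  by move=> Ga Gb; apply/le_anti/andP; split; exact: le_ab.
move=> Gc Gd; have /Gle := GP (-1) _ _ _ _ Gd Gc.
by rewrite scaleN1r addNr normr0 mulr0 mulN1r addrC subr_le0.
Qed.

Lemma dominated_graph_scale M G (c : R) x a :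
  dominated_graph M G -> G (x, a) -> G (c *: x, c * a).
Proof. by move=> [G0 GP _] /(GP c _ _ 0 0)/(_ G0); rewrite !addr0. Qed.

(** The value [r] at [v] must satisfy [a - M * |x - v| <= r <= M * |y + v| - b] for all pairs
    [(x, a)] and [(y, b)] of [G]. The triangle inequality makes these constraints compatible, and
    the supremum of the left sides meets them all. *)
Lemma dominated_graph_extend M G v :
  0 <= M -> dominated_graph M G ->
  exists r, dominated_graph M
    [set xa | exists c y b, G (y, b) /\ xa = (y + c *: v, b + c * r)].
Proof.
move=> M0 GG; have [G0 GP Gle] := GG.
pose S := [set s | exists x a, G (x, a) /\ s = a - M * `|x - v|].
have Sub y b : G (y, b) -> ubound S (M * `|y + v| - b).
  move=> Gyb _ [x [a [Gxa ->]]].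
  rewrite lerBlDr addrAC lerBrDr.
  have /Gle := GP 1 _ _ _ _ Gxa Gyb; rewrite scale1r mul1r => /le_trans; apply.
  rewrite -mulrDr ler_wpM2l// (_ : x + y = (y + v) + (x - v)) ?ler_normD//.
  by rewrite addrACA subrr addr0 addrC.
have S0 : S !=set0 by exists (0 - M * `|0 - v|); exists 0, 0.
have hS : has_sup S by split => //; exists (M * `|0 + v| - 0); exact: Sub G0.
exists (sup S).
split.
- by exists 0, 0, 0; split => //; rewrite scale0r mul0r !addr0.
- move=> c x a y b [c1 [y1 [b1 [G1 [-> ->]]]]] [c2 [y2 [b2 [G2 [-> ->]]]]].
  exists (c * c1 + c2), (c *: y1 + y2), (c * b1 + b2); split; first exact: GP.
  congr pair; last by ring.
  by rewrite scalerDr scalerDl scalerA addrACA.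
- move=> x a [c [y [b [Gyb [-> ->]]]]].
  (* After division by [|c|], a positive [c] uses the upper constraint on [sup S] and a negative [c]
     the lower one. *)
  have [c0|c0|->] := ltgtP c 0; last first.
  + by rewrite scale0r mul0r !addr0; exact: Gle.
  + have Gs : G (c^-1 *: y, c^-1 * b) by exact: dominated_graph_scale GG Gyb.
    have le1 : sup S <= M * `|c^-1 *: y + v| - c^-1 * b.
      by apply: sup_le_ub => //; exact: Sub.
    have -> : y + c *: v = c *: (c^-1 *: y + v).
      by rewrite scalerDr scalerA mulfV ?gt_eqF// scale1r.
    rewrite normrZ gtr0_norm//.
    move: le1; rewrite -(ler_pM2l c0) mulrBr [c * (c^-1 * b)]mulrA mulfV ?gt_eqF// mul1r.
    by rewrite lerBrDl mulrCA.
  + pose d := - c; have d0 : 0 < d by rewrite oppr_gt0.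
    have Gs : G (d^-1 *: y, d^-1 * b) by exact: dominated_graph_scale GG Gyb.
    have le1 : d^-1 * b - M * `|d^-1 *: y - v| <= sup S.
      by apply: sup_upper_bound => //; exists (d^-1 *: y), (d^-1 * b).
    have -> : y + c *: v = d *: (d^-1 *: y - v).
      by rewrite scalerBr scalerA mulfV ?gt_eqF// scale1r /d scaleNr opprK.
    rewrite normrZ gtr0_norm//.
    move: le1; rewrite -(ler_pM2l d0) mulrBr [d * (d^-1 * b)]mulrA mulfV ?gt_eqF// mul1r.
    rewrite (_ : c * sup S = - (d * sup S)); last by rewrite /d mulNr opprK.
    by rewrite lerBlDr lerBlDl mulrCA.
Qed.

(** Zorn's lemma yields a maximal dominated graph; the one-dimensional extension shows that it is
    defined everywhere. The one-sided bound, read at [- x], bounds the absolute value. *)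
Lemma hahn_banach M G : 0 <= M -> dominated_graph M G ->
  exists2 phi : dual V, (forall x a, G (x, a) -> phi x = a) &
    forall x, `|phi x| <= M * `|x|.
Proof.
move=> M0 GG.
(* Taking the union with [G] makes the empty chain harmless. *)
pose P := [set A : set (V * R) | dominated_graph M (A `|` G)].
have [|A [PA Amax]] := @Zorn_bigcup _ P.
  move=> F FP Ftot.
  (* With the empty set added to the chain, a pair that lies in [G] only is also covered by some
     member joined with [G]. *)
  pose F' := F `|` [set set0].
  have F'P X : F' X -> dominated_graph M (X `|` G).
    by move=> [/FP//|->]; rewrite set0U.
  have F'tot X Z : F' X -> F' Z -> X `<=` Z \/ Z `<=` X.
    by move=> [FX|->] [FZ|->]; [exact: Ftot|right|left|left].
  have UF u : (\bigcup_(X in F) X `|` G) u -> exists2 X, F' X & (X `|` G) u.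
    move=> [[X FX Xu]|Gu]; first by exists X; left.
    by exists set0; right.
  have FU X : F' X -> X `|` G `<=` \bigcup_(X in F) X `|` G.
    move=> F'X u [Xu|Gu]; last by right.
    by case: F'X => [FX|X0]; [left; exists X|rewrite X0 in Xu].
  split.
  - by right; have [] := GG.
  - move=> c x a y b /UF[X FX Xx] /UF[Z FZ Zy].
    have [XZ|ZX] := F'tot _ _ FX FZ.
      apply: (FU _ FZ); have [_ + _] := F'P _ FZ; apply => //.
      by case: Xx => [/XZ|]; [left|right].
    apply: (FU _ FX); have [_ + _] := F'P _ FX; apply => //.
    by case: Zy => [/ZX|]; [left|right].
  - by move=> x a /UF[X FX]; have [_ _] := F'P _ FX; apply.
pose H := A `|` G.
have HH : dominated_graph M H by [].
have Htot v : exists r, H (v, r).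
  have [r HE] := dominated_graph_extend v M0 HH.
  set E := [set _ | _] in HE.
  have HsubE : H `<=` E.
    by move=> [x a] Hxa; exists 0, x, a; split => //; rewrite scale0r mul0r !addr0.
  exists r; apply: contrapT => nHvr; apply: (Amax E).
    split; first by apply: subset_trans HsubE => u Au; left.
    move=> EA; apply: nHvr; left; apply: EA.
    exists 1, 0, 0; split; first exact: (dominated_graph0 HH).
    by rewrite scale1r mul1r !add0r.
  by rewrite /P/= (_ : E `|` G = E)//; apply/setUidPl => u Gu; apply: HsubE; right.
have [g gP] := choice Htot.
have gfun x a : H (x, a) -> g x = a by move=> Hx; exact: dominated_graph_fun HH (gP x) Hx.
have glin c x y : g (c *: x + y) = c * g x + g y.
  by apply: gfun; exact: (dominated_graphP HH).
have gle x : g x <= M * `|x| by exact: (dominated_graph_le HH (gP x)).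
have gabs x : `|g x| <= M * `|x|.
  rewrite ler_norml gle andbT lerNl.
  have -> : - g x = g (- x).
    apply/esym/gfun; have := dominated_graph_scale (-1) HH (gP x).
    by rewrite scaleN1r mulN1r.
  by rewrite (le_trans (gle _))// normrN.
have [phi phig] := dual_intro glin gabs.
exists phi => [x a Gx|x]; rewrite phig//.
by apply: gfun; right.
Qed.

End HahnBanach.

(** * Functionals adapted to a subspace, and finite codimension *)

Section Subspaces.
Context (R : realType) (V : normedModType R).
Implicit Types (Z : set V) (phi : dual V).

Lemma dual_norm_bound phi M :
  0 <= M -> (forall x, `|phi x| <= M * `|x|) -> `|phi| <= M.
Proof.
move=> M0 phiM; apply: dual_norm_le => x x1.
by rewrite (le_trans (phiM x))// ler_piMr.
Qed.

Lemma dual_apply_le phi x : `|phi x| <= `|phi| * `|x|.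
Proof. exact: dual_norm_mul. Qed.

Lemma dual_sum_apply (I : Type) (s : seq I) (F : I -> dual V) x :
  (\sum_(i <- s) F i) x = \sum_(i <- s) F i x.
Proof. by elim/big_rec2: _ => // i u v _ <-. Qed.

Lemma submod_closedP Z : submod_closed (mem Z) <->
  Z 0 /\ forall (c : R) x y, Z x -> Z y -> Z (c *: x + y).
Proof.
split=> [[Z0 ZP]|[Z0 ZP]]; split.
- by move: Z0; rewrite inE.
- by move=> c x y Zx Zy; have := ZP c x y; rewrite !inE; apply.
- by rewrite inE.
- by move=> c x y; rewrite !inE; exact: ZP.
Qed.

Lemma norming_functional (x : V) :
  exists2 phi : dual V, phi x = `|x| & `|phi| <= 1.
Proof.
pose G := [set va | exists c : R, va = (c *: x, c * `|x|)].
have GG : dominated_graph 1 G.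
  split.
  - by exists 0; rewrite scale0r mul0r.
  - move=> c _ _ _ _ [a [-> ->]] [b [-> ->]]; exists (c * a + b).
    by rewrite scalerDl mulrDl scalerA mulrA.
  - by move=> _ _ [c [-> ->]]; rewrite mul1r normrZ ler_wpM2r// ler_norm.
have [phi phiG phi1] := hahn_banach ler01 GG.
exists phi; last exact: dual_norm_bound.
by apply: phiG; exists 1; rewrite scale1r mul1r.
Qed.

(** Closedness gives a ball of radius [d] around [b] that misses [Z], so [z + c *: b] has norm at
    least [|c| * d], and the functional with value [c] there is dominated with constant [d^-1]. *)
Lemma separating_functional Z b : closed Z -> submod_closed (mem Z) -> ~ Z b ->
  exists2 psi : dual V, (forall z, Z z -> psi z = 0) & psi b = 1.
Proof.
move=> cZ /submod_closedP[Z0 ZP] Zb.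
have [d d0 dZ] : exists2 d : R, 0 < d & forall z, Z z -> d <= `|b - z|.
  have /nbhs_ballP[d /= d0 dZ] : nbhs b (~` Z).
    by apply: open_nbhs_nbhs; split => //; exact: closed_openC.
  exists d => // z Zz; rewrite leNgt; apply/negP => bz.
  by apply: (dZ z) => //; rewrite -ball_normE.
have ZZ (c : R) z : Z z -> Z (c *: z) by move=> Zz; rewrite -[_ *: _]addr0; exact: ZP.
pose G := [set va | exists (c : R) z, Z z /\ va = (z + c *: b, c)].
have GG : dominated_graph d^-1 G.
  split.
  - by exists 0, 0; rewrite scale0r addr0.
  - move=> c _ _ _ _ [a [z [Zz [-> ->]]]] [a' [z' [Zz' [-> ->]]]].
    exists (c * a + a'), (c *: z + z'); split; first exact: ZP.
    by rewrite scalerDl scalerDr scalerA addrACA.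
  - move=> _ _ [c [z [Zz [-> ->]]]]; rewrite ler_pdivlMl//.
    have [->|c0] := eqVneq c 0; first by rewrite mulr0.
    have -> : z + c *: b = c *: (b - (- c^-1) *: z).
      by rewrite scalerBr scalerA mulrN mulfV// scaleN1r opprK addrC.
    rewrite normrZ mulrC (le_trans (ler_wpM2r (ltW d0) (ler_norm c)))//.
    by rewrite ler_wpM2l// dZ//; exact: ZZ.
have dV0 : 0 <= d^-1 by rewrite invr_ge0 ltW.
have [psi psiG _] := hahn_banach dV0 GG.
exists psi => [z Zz|]; apply: psiG.
  by exists 0, z; rewrite scale0r addr0.
by exists 1, 0; rewrite scale1r add0r.
Qed.

(** The point is that [M] bounds [phi] on [Z] only and may be far below the norm of [phi]: the
    restriction to [Z] is extended afresh. *)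
Lemma functional_extension Z phi M : 0 <= M -> submod_closed (mem Z) ->
  (forall z, Z z -> phi z <= M * `|z|) ->
  exists2 psi : dual V, (forall z, Z z -> psi z = phi z) & `|psi| <= M.
Proof.
move=> M0 /submod_closedP[Z0 ZP] phiM.
pose G := [set va | exists z, Z z /\ va = (z, phi z : R)].
have GG : dominated_graph M G.
  split.
  - by exists 0; rewrite linear0.
  - move=> c _ _ _ _ [x [Zx [-> ->]]] [y [Zy [-> ->]]].
    by exists (c *: x + y); split; [exact: ZP|rewrite linearP].
  - by move=> _ _ [z [Zz [-> ->]]]; exact: phiM.
have [psi psiG psiM] := hahn_banach M0 GG.
exists psi; last exact: dual_norm_bound.
by move=> z Zz; apply: psiG; exists z.
Qed.

Lemma finite_codim_decomposition Z :
  closed Z -> submod_closed (mem Z) -> finite_codim Z ->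
  exists s : seq (dual V * V), forall v, Z (v - \sum_(p <- s) p.1 v *: p.2).
Proof.
move=> cZ sZ [n [b]]; elim: n Z cZ sZ b => [|n IHn] Z cZ sZ b bZ.
  exists [::] => v; rewrite big_nil.
  by have [c] := bZ v; rewrite big_ord0.
have [Z0 ZP] := (submod_closedP Z).1 sZ.
have ZD x y : Z x -> Z y -> Z (x + y).
  by move=> Zx Zy; rewrite -[x]scale1r; exact: ZP.
have ZZ (c : R) z : Z z -> Z (c *: z) by move=> Zz; rewrite -[_ *: _]addr0; exact: ZP.
have [Zb|Zb] := pselect (Z (b ord0)).
  apply: (IHn _ cZ sZ (b \o lift ord0)) => v.
  have [c cP] := bZ v; exists (c \o lift ord0).
  rewrite (_ : _ - _ = (v - \sum_(i < n.+1) c i *: b i) + c ord0 *: b ord0).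
    by apply: ZD => //; exact: ZZ.
  by rewrite big_ord_recl/= opprD addrA addrAC addrNK.
have [psi psiZ psib] := separating_functional cZ sZ Zb.
(* This is the sum of [Z] and the line of [b ord0]; as a preimage of [Z] under a continuous map it
   is visibly closed. *)
pose Z' := [set v | Z (v - psi v *: b ord0)].
have [|||s sP] := IHn Z' _ _ (b \o lift ord0).
- apply: (@closed_comp _ _ (fun v => v - psi v *: b ord0)) => // v _.
  apply: cvgB => //; apply: cvgZr_tmp; exact: dual_continuous.
- apply/submod_closedP; split; first by rewrite /Z'/= linear0 scale0r subrr.
  move=> c x y Zx Zy; rewrite /Z'/=.
  have -> : c *: x + y - psi (c *: x + y) *: b ord0 =
      c *: (x - psi x *: b ord0) + (y - psi y *: b ord0).
    by rewrite linearP/= scalerDl scalerBr opprD addrACA scalerA.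
  exact: ZP.
- move=> v; have [c cP] := bZ v; exists (c \o lift ord0); rewrite /Z'/=.
  move: cP; rewrite big_ord_recl /= opprD addrA addrAC.
  set x := v - _ => xZ.
  (* Since [psi] vanishes on [Z] and is [1] at [b ord0], it recovers the discarded coefficient. *)
  have -> : psi x = c ord0; last exact: xZ.
  by have := psiZ _ xZ; rewrite linearB linearZ/= psib [_ *: _]mulr1 => /subr0_eq.
(* [psi'] applies [psi] to what remains of a vector after the terms of [s] are subtracted. *)
pose psi' := psi - \sum_(p <- s) psi p.2 *: p.1.
have psi'E v : (psi', b ord0).1 v = psi (v - \sum_(p <- s) p.1 v *: p.2).
  rewrite [LHS]dualDE linearB/=; congr (_ - _).
  by rewrite dual_sum_apply linear_sum; apply: eq_bigr => p _; rewrite linearZ; exact: mulrC.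
exists ((psi', b ord0) :: s) => v.
by rewrite big_cons psi'E opprD addrA addrAC; exact: sP.
Qed.

End Subspaces.

(** * The modulus of asymptotic smoothness *)

(** These weights write [s v + d u] as [a (v + u) + b (v - u)], which feeds the convexity arguments
    below. *)
Lemma ex_sum_diff (R : realFieldType) (d s : R) : 0 <= d -> d <= s ->
  exists a b : R, [/\ 0 <= a, 0 <= b, a + b = s & a - b = d].
Proof. by move=> d0 ds; exists ((s + d) / 2), ((s - d) / 2); split; lra. Qed.

Lemma norm_conical_le (R : realType) (V : normedModType R) (a b B : R) (x y : V) :
  0 <= a -> 0 <= b -> `|x| <= B -> `|y| <= B -> `|a *: x + b *: y| <= (a + b) * B.
Proof.
move=> a0 b0 xB yB; rewrite mulrDl (le_trans (ler_normD _ _))//.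
by rewrite !normrZ !ger0_norm// lerD// ler_wpM2l.
Qed.

(** * The canonical embedding into the bidual *)

Section CanonicalRange.
Context (R : realType) (Y : normedModType R).
Local Notation emb := (@canonical_embedding R Y).

Lemma canonical_embeddingP (c : R) x y : emb (c *: x + y) = c *: emb x + emb y.
Proof. by apply: dual_ext => phi; rewrite [LHS]linearP. Qed.

Lemma canonical_embedding0 : emb 0 = 0.
Proof. by apply: dual_ext => phi; rewrite [LHS]linear0. Qed.

Lemma canonical_embeddingZ (c : R) x : emb (c *: x) = c *: emb x.
Proof. by rewrite -[c *: x]addr0 canonical_embeddingP canonical_embedding0 addr0. Qed.

Lemma canonical_embeddingB x y : emb (x - y) = emb x - emb y.
Proof. by rewrite addrC -scaleN1r canonical_embeddingP scaleN1r addrC. Qed.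

Lemma canonical_embedding_isometry x : `|emb x| = `|x|.
Proof.
apply/le_anti/andP; split.
  apply: dual_norm_bound => // phi.
  by rewrite mulrC; exact: (dual_apply_le phi x).
have [phi phix phi1] := norming_functional x.
rewrite -phix (le_trans (ler_norm _))//.
rewrite (le_trans (dual_apply_le (emb x) phi))//.
by rewrite ler_piMr.
Qed.

Lemma canonical_range_submod : submod_closed (mem (range emb)).
Proof.
apply/submod_closedP; split; first by exists 0 => //; exact: canonical_embedding0.
by move=> c _ _ [x _ <-] [y _ <-]; exists (c *: x + y); rewrite ?canonical_embeddingP.
Qed.

End CanonicalRange.

(** The points of [Y] whose images approach [x] form a Cauchy filter because the embedding is
    isometric; completeness of [Y] gives its limit, which is sent to [x]. *)
Lemma canonical_range_closed (R : realType) (Y : completeNormedModType R) :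
  closed (range (@canonical_embedding R Y)).
Proof.
move=> x clx.
have approx e : 0 < e -> exists y : Y, `|x - canonical_embedding y| < e.
  move=> e0; have [_ [[y _ <-] xy]] := clx _ (nbhsx_ballx x e e0).
  by exists y; move: xy; rewrite -ball_normE.
pose F := filter_from [set e : R | 0 < e]
  (fun e => [set y : Y | `|x - canonical_embedding y| < e]).
have FF : ProperFilter F.
  apply: filter_from_proper; last by move=> e /= e0; exact: approx.
  apply: filter_from_filter; first by exists 1 => /=.
  move=> e e' /= e0 e'0; exists (Num.min e e') => /=; first by rewrite lt_min e0.
  by move=> y /=; rewrite lt_min => /andP[].
have FC : cauchy F.
  apply: cauchy_exP => e e0; have e20 : 0 < e / 2 by rewrite divr_gt0.
  have [y0 xy0] := approx _ e20; exists y0; exists (e / 2) => // y /= xy.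
  rewrite -ball_normE /= -canonical_embedding_isometry canonical_embeddingB.
  have -> : canonical_embedding y0 - canonical_embedding y =
     (x - canonical_embedding y) - (x - canonical_embedding y0).
    by rewrite opprB [RHS]addrC subrKA.
  by rewrite (le_lt_trans (ler_normB _ _))// [e]splitr ltrD.
have /cvg_ex[l Fl] : cvg F by apply/cauchy_cvgP.
exists l => //; apply/esym/subr0_eq/normr0_eq0/le_anti; rewrite normr_ge0 andbT.
apply/ler_addgt0Pl => e e0; rewrite addr0; have e20 : 0 < e / 2 by rewrite divr_gt0.
have Fb : F (ball l (e / 2)) by apply: Fl; exact: nbhsx_ballx.
have Fx : F [set y : Y | `|x - canonical_embedding y| < e / 2] by exists (e / 2).
have [y [ly xy]] := filter_ex (filterI Fb Fx).
rewrite -(subrK (canonical_embedding y) x) -addrA -canonical_embeddingB.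
rewrite (le_trans (ler_normD _ _))// canonical_embedding_isometry [e]splitr lerD ?ltW//.
by move: ly; rewrite -ball_normE/= distrC.
Qed.

(** * Elementary properties of the modulus *)

Section RhoBar.
Context (R : realType) (Y : normedModType R).
Implicit Types (y z : Y) (Z : set Y) (s t : R).

Lemma rho_bar_at_ub t y Z : `|y| = 1 -> 0 <= t ->
  ubound [set `|y + t *: z| - 1 | z in [set z | Z z /\ `|z| = 1]] t.
Proof.
move=> y1 t0 _ [z [_ z1] <-]; rewrite lerBlDl.
by rewrite (le_trans (ler_normD _ _))// y1 normrZ z1 mulr1 ger0_norm.
Qed.

Lemma rho_bar_at_ge t y Z z : `|y| = 1 -> 0 <= t -> Z z -> `|z| = 1 ->
  `|y + t *: z| <= 1 + rho_bar_at t y Z.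
Proof.
move=> y1 t0 Zz z1; rewrite -lerBlDl; apply: ub_le_sup; last by exists z.
by exists t; exact: rho_bar_at_ub.
Qed.

Lemma rho_bar_at_le t y Z B : 0 <= B ->
  (forall z, Z z -> `|z| = 1 -> `|y + t *: z| <= 1 + B) -> rho_bar_at t y Z <= B.
Proof.
move=> B0 zB; rewrite /rho_bar_at; set E := [set _ | _ in _].
(* A subspace without unit vectors gives the default supremum [0], whence the requirement
   [0 <= B]. *)
have [->|/set0P E0] := eqVneq E set0; first by rewrite sup0.
apply: sup_le_ub => // _ [z [Zz z1] <-].
by rewrite lerBlDl zB.
Qed.

Lemma rho_bar_at_opp t y Z z : `|y| = 1 -> 0 <= t -> submod_closed (mem Z) ->
  Z z -> `|z| = 1 -> `|y - t *: z| <= 1 + rho_bar_at t y Z.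
Proof.
move=> y1 t0 /submod_closedP[Z0 ZP] Zz z1.
rewrite -scalerN rho_bar_at_ge ?normrN//.
by rewrite -[- z]addr0 -scaleN1r; exact: ZP.
Qed.

(** The unit vector [y] is the midpoint of [y + t *: z] and [y - t *: z], so these cannot both have
    norm below [1]. *)
Lemma rho_bar_at_ge0 t y Z : `|y| = 1 -> 0 <= t -> submod_closed (mem Z) ->
  0 <= rho_bar_at t y Z.
Proof.
move=> y1 t0 sZ.
have [[z [Zz z1]]|nz] := pselect (exists z, Z z /\ `|z| = 1); last first.
  rewrite /rho_bar_at (_ : [set _ | _ in _] = set0) ?sup0// -subset0.
  by move=> r [z zZ _]; apply: nz; exists z.
have le1 := rho_bar_at_ge y1 t0 Zz z1; have le2 := rho_bar_at_opp y1 t0 sZ Zz z1.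
have : `|y *+ 2| <= `|y + t *: z| + `|y - t *: z|.
  by rewrite (le_trans _ (ler_normD _ _))// addrACA subrr addr0 mulr2n.
rewrite normrMn y1; lra.
Qed.

(* [y + s z] lies between [y + t z] and [y - t z]. *)
Lemma rho_bar_at_mono s t y Z : `|y| = 1 -> 0 <= s -> s <= t -> submod_closed (mem Z) ->
  rho_bar_at s y Z <= rho_bar_at t y Z.
Proof.
move=> y1 s0 st sZ; have t0 := le_trans s0 st.
apply: rho_bar_at_le; first exact: rho_bar_at_ge0.
move=> z Zz z1.
have [s_eq0|sn0] := eqVneq s 0.
  by rewrite s_eq0 scale0r addr0 y1 lerDl rho_bar_at_ge0.
have tp : 0 < t by rewrite (lt_le_trans _ st)// lt_def sn0.
have le1 := rho_bar_at_ge y1 t0 Zz z1; have le2 := rho_bar_at_opp y1 t0 sZ Zz z1.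
have st1 : s / t <= 1 by rewrite ler_pdivrMr// mul1r.
have st0 : 0 <= s / t by rewrite divr_ge0.
have [a [b [a0 b0 abD abB]]] := ex_sum_diff st0 st1.
have -> : y + s *: z = a *: (y + t *: z) + b *: (y - t *: z).
  rewrite !scalerDr addrACA -scalerDl scalerN !scalerA -scalerBl -mulrBl abD abB.
  by rewrite scale1r divfK ?gt_eqF.
by apply: le_trans (norm_conical_le a0 b0 le1 le2) _; rewrite abD mul1r.
Qed.

Local Notation subspaces :=
  [set Z : set Y | [/\ closed Z, submod_closed (mem Z) & finite_codim Z]].

Lemma subspaces_setT : subspaces setT.
Proof.
split; first exact: closedT.
  by apply/submod_closedP.
by exists 0, (fun=> 0) => v; exists (fun=> 0).
Qed.

Lemma rho_bar_pt_has_inf t y : `|y| = 1 -> 0 <= t ->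
  has_inf [set rho_bar_at t y Z | Z in subspaces].
Proof.
move=> y1 t0; split.
  by exists (rho_bar_at t y setT), setT => //; exact: subspaces_setT.
by exists 0 => _ [Z [_ sZ _] <-]; exact: rho_bar_at_ge0.
Qed.

Lemma rho_bar_pt_ge0 t y : `|y| = 1 -> 0 <= t -> 0 <= rho_bar_pt t y.
Proof.
move=> y1 t0; apply: lb_le_inf; first by have [] := rho_bar_pt_has_inf y1 t0.
by move=> _ [Z [_ sZ _] <-]; exact: rho_bar_at_ge0.
Qed.

Lemma rho_bar_pt_le_at t y Z : `|y| = 1 -> 0 <= t -> subspaces Z ->
  rho_bar_pt t y <= rho_bar_at t y Z.
Proof.
by move=> y1 t0 sZ; apply: ge_inf; [have [] := rho_bar_pt_has_inf y1 t0|exists Z].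
Qed.

Lemma rho_bar_pt_le t y : `|y| = 1 -> 0 <= t -> rho_bar_pt t y <= rho_bar Y t.
Proof.
move=> y1 t0; apply: ub_le_sup; last by exists y.
exists t => _ [x x1 <-]; rewrite (le_trans (rho_bar_pt_le_at x1 t0 subspaces_setT))//.
apply: rho_bar_at_le => // z _ z1.
by rewrite (le_trans (ler_normD _ _))// x1 normrZ z1 mulr1 ger0_norm.
Qed.

Lemma rho_bar_ge0 t : 0 <= t -> 0 <= rho_bar Y t.
Proof.
move=> t0; have [[y y1]|ny] := pselect (exists y : Y, `|y| = 1).
  by rewrite (le_trans (rho_bar_pt_ge0 y1 t0))// rho_bar_pt_le.
rewrite /rho_bar (_ : [set _ | _ in _] = set0) ?sup0// -subset0.
by move=> r [y y1 _]; apply: ny; exists y.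
Qed.

Lemma rho_bar_mono s t : 0 <= s -> s <= t -> rho_bar Y s <= rho_bar Y t.
Proof.
move=> s0 st; have t0 := le_trans s0 st.
rewrite {1}/rho_bar; set E := [set _ | _ in _].
have [->|/set0P E0] := eqVneq E set0; first by rewrite sup0 rho_bar_ge0.
apply: sup_le_ub => // _ [y y1 <-].
apply: le_trans (rho_bar_pt_le y1 t0).
apply: lb_le_inf; first by have [] := rho_bar_pt_has_inf y1 t0.
move=> _ [Z sZ <-]; rewrite (le_trans (rho_bar_pt_le_at y1 s0 sZ))//.
by apply: rho_bar_at_mono => //; have [] := sZ.
Qed.

Lemma rho_bar_at_approx t y eps : `|y| = 1 -> 0 <= t -> 0 < eps ->
  exists2 Z, [/\ closed Z, submod_closed (mem Z) & finite_codim Z] &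
    rho_bar_at t y Z < rho_bar Y t + eps.
Proof.
move=> y1 t0 e0.
have [_ [Z sZ <-] Zlt] := inf_adherent e0 (rho_bar_pt_has_inf y1 t0).
by exists Z => //; rewrite (lt_le_trans Zlt)// lerD2r rho_bar_pt_le.
Qed.

End RhoBar.

(** * Adding a weak* null family to a vector of the space *)

Section WeakStarSmoothness.
Context (R : realType) (Y : normedModType R).
Local Notation emb := (@canonical_embedding R Y).

(** A functional that vanishes on [Z] ignores the remainder in [Z], so it is determined by its
    values at the vectors of [s]. *)
Lemma annihilator_decomposition (Z : set Y) (s : seq (dual Y * Y)) (chi : dual Y) :
  (forall v, Z (v - \sum_(p <- s) p.1 v *: p.2)) -> (forall z, Z z -> chi z = 0) ->
  chi = \sum_(p <- s) chi p.2 *: p.1.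
Proof.
move=> sP chiZ; apply: dual_ext => v; rewrite dual_sum_apply.
have := chiZ _ (sP v); rewrite linearB/= => /subr0_eq ->.
by rewrite linear_sum; apply: eq_bigr => p _; rewrite linearZ; exact: mulrC.
Qed.

(** By duality: if [|phi| <= 1], then [phi y + t * phi z <= 1 + rho_bar_at t y Z] for unit vectors
    [z] of [Z]. A large [phi y] thus forces [phi] to be small on [Z], and only that restriction acts
    substantially on [w]. *)
Lemma weak_star_smooth_at (y : Y) (Z : set Y) (s : seq (dual Y * Y)) (t eta : R)
    (w : bidual Y) :
  `|y| = 1 -> 0 < t -> submod_closed (mem Z) ->
  (forall v, Z (v - \sum_(p <- s) p.1 v *: p.2)) ->
  `|w| <= t -> \sum_(p <- s) `|p.2| * `|w p.1| <= eta ->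
  `|emb y + w| <= 1 + rho_bar_at t y Z + 2 * eta.
Proof.
move=> y1 t0 sZ sP wt weta.
have rho0 : 0 <= rho_bar_at t y Z by rewrite rho_bar_at_ge0// ltW.
suff le_phi (phi : dual Y) : `|phi| <= 1 ->
    phi y + w phi <= 1 + rho_bar_at t y Z + 2 * eta.
  apply: dual_norm_le => phi phi1; rewrite ler_norml; apply/andP; split.
    rewrite lerNl; have := le_phi (- phi); rewrite normrN => /(_ phi1).
    rewrite linearN; congr (_ <= _).
    by rewrite [RHS]opprD.
  exact: le_phi.
move=> phi1.
have phi_le v : phi v <= `|v|.
  by rewrite (le_trans (ler_norm _))// (le_trans (dual_apply_le _ _))// ler_piMl.
pose q := 1 + rho_bar_at t y Z - phi y.
have q0 : 0 <= q by have := phi_le y; rewrite y1 /q => ?; lra.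
(* The bound [q / t] makes [w psi <= q]; the bound [1] gives [|phi - psi| <= 2], the source of the
   factor in [2 * eta]. *)
pose m := Num.min (q / t) 1.
have m0 : 0 <= m by rewrite le_min ler01 andbT divr_ge0// ltW.
have phim z : Z z -> phi z <= m * `|z|.
  move=> Zz; have [->|z0] := eqVneq z 0; first by rewrite linear0 normr0 mulr0.
  have z_gt0 : 0 < `|z| by rewrite normr_gt0.
  rewrite -ler_pdivrMr// le_min; apply/andP; split; last first.
    by rewrite ler_pdivrMr// mul1r.
  rewrite ler_pdivlMr// lerBrDl.
  pose z' := `|z|^-1 *: z.
  have z'1 : `|z'| = 1 by rewrite normrZ gtr0_norm ?invr_gt0// mulVf// gt_eqF.
  have Zz' : Z z'.
    have /submod_closedP[Z0 ZP] := sZ.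
    by rewrite /z' -[_ *: z]addr0; exact: ZP.
  apply: le_trans (rho_bar_at_ge y1 (ltW t0) Zz' z'1).
  apply: le_trans (phi_le _); rewrite linearD linearZ/= lerD2l.
  by rewrite /z' linearZ/= [leRHS]mulrC [_ *: _]mulrC.
(* [w phi = w psi + w (phi - psi)], where [psi] extends the restriction of [phi] to [Z] with small
   norm and [phi - psi] annihilates [Z], hence is a combination of the functionals of [s]. *)
have [psi psiZ psim] := functional_extension m0 sZ phim.
have w_psi : w psi <= q.
  rewrite (le_trans (ler_norm _))// (le_trans (dual_apply_le _ _))//.
  rewrite (le_trans (ler_pM _ _ wt psim))// /m mulrC -ler_pdivlMr//.
  by rewrite ge_min lexx.
have w_diff : w (phi - psi) <= 2 * eta.
  pose chi := phi - psi.
  have chi2 : `|chi| <= 2.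
    rewrite (le_trans (ler_normB _ _))// -[2]/(1 + 1) lerD// (le_trans psim)//.
    by rewrite ge_min lexx orbT.
  have chiZ z : Z z -> chi z = 0
    by move=> Zz; rewrite (_ : chi z = phi z - psi z)// psiZ// subrr.
  rewrite -/chi (annihilator_decomposition sP chiZ).
  rewrite linear_sum; apply: le_trans (ler_norm _) _.
  apply: le_trans (ler_norm_sum _ _ _) _.
  apply: le_trans (ler_wpM2l _ weta) => //; rewrite mulr_sumr ler_sum// => p _.
  rewrite linearZ normrM mulrA ler_wpM2r//.
  by rewrite (le_trans (dual_apply_le _ _))// ler_wpM2r.
have -> : w phi = w psi + w (phi - psi) by rewrite linearB addrC subrK.
by move: w_psi w_diff; rewrite /q => ? ?; lra.
Qed.

Lemma near_sum_le (I : Type) (F : set_system I) {FF : Filter F} (s : seq (dual Y * Y))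
    (w : I -> bidual Y) (eta : R) :
  (forall phi, (fun i => w i phi : R) @ F --> (0 : R)) -> 0 < eta ->
  \forall i \near F, \sum_(p <- s) `|p.2| * `|w i p.1| <= eta.
Proof.
move=> w0 eta0.
have : (fun i => \sum_(p <- s) `|p.2| * `|w i p.1|) @ F --> (0 : R).
  elim: s => [|p s IHs].
    under eq_fun do rewrite big_nil.
    exact: cvg_cst.
  under eq_fun do rewrite big_cons.
  have h : (fun i => `|p.2| * `|w i p.1|) @ F --> `|p.2| * (0 : R).
    by apply: cvgMl_tmp; have := cvg_norm (w0 p.1); rewrite normr0; apply.
  by have := cvgD h IHs; rewrite mulr0 addr0; apply.
move=> /cvgr_le; exact.
Qed.

Lemma weak_star_smooth_sphere (I : Type) (F : set_system I) {FF : Filter F} (y : Y) (t eta : R)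
    (w : I -> bidual Y) :
  (forall phi, (fun i => w i phi : R) @ F --> (0 : R)) ->
  (\forall i \near F, `|w i| <= t) -> `|y| = 1 -> 0 < t -> 0 < eta ->
  \forall i \near F, `|emb y + w i| <= 1 + rho_bar Y t + eta.
Proof.
move=> w0 wt y1 t0 eta0.
(* Half of [eta] pays for the choice of [Z], the other half is twice the [eta / 4] allowed to the
   finite sum. *)
have [|Z [cZ sZ fZ] Zlt] := @rho_bar_at_approx _ _ t y (eta / 2) y1 (ltW t0).
  by rewrite divr_gt0.
have [s sP] := finite_codim_decomposition cZ sZ fZ.
have eta4 : 0 < eta / 4 by rewrite divr_gt0.
apply: filterS2 wt (near_sum_le s w0 eta4) => i wit wis.
apply: le_trans (weak_star_smooth_at y1 t0 sZ sP wit wis) _; lra.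
Qed.

Lemma weak_star_smooth (I : Type) (F : set_system I) {FF : Filter F} (u : Y) (r t eta : R)
    (w : I -> bidual Y) :
  (forall phi, (fun i => w i phi : R) @ F --> (0 : R)) ->
  (\forall i \near F, `|w i| <= t) -> `|u| <= r -> 0 < r -> 0 < t -> 0 < eta ->
  \forall i \near F, `|emb u + w i| <= r * (1 + rho_bar Y (t / r)) + eta.
Proof.
move=> w0 wt ur r0 t0 eta0.
have rho0 : 0 <= rho_bar Y (t / r) by rewrite rho_bar_ge0// divr_ge0// ltW.
(* For [u = 0] any unit vector [e] serves, with [a = 0]; the alternative therefore leaves only the
   zero space, whose bidual is zero. *)
have [[e [a [e1 a0 uE]]]|triv] :=
    pselect (exists e (a : R), [/\ `|e| = 1, 0 <= a & u = a *: e]); last first.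
  have Y0 (y : Y) : y = 0.
    have unit_vec (x : Y) : x != 0 -> `| (`|x|^-1 *: x) | = 1.
      by move=> x0; rewrite normrZ normfV normr_id mulVf ?normr_eq0.
    apply: contrapT => /eqP y0; apply: triv.
    have [->|u0] := eqVneq u 0; last first.
      exists (`|u|^-1 *: u), `|u|; rewrite unit_vec//; split => //.
      by rewrite scalerA mulfV ?normr_eq0// scale1r.
    by exists (`|y|^-1 *: y), 0; rewrite unit_vec// scale0r.
  apply: filterE => i.
  have -> : emb u + w i = 0.
    apply: dual_ext => phi; rewrite (_ : phi = 0) ?linear0//.
    by apply: dual_ext => y; rewrite (Y0 y) linear0.
  by rewrite normr0 addr_ge0 ?mulr_ge0 ?addr_ge0// ltW.
have ar : a <= r by move: ur; rewrite uE normrZ e1 mulr1 ger0_norm.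
pose w' i := r^-1 *: w i.
have w'0 phi : (fun i => w' i phi : R) @ F --> (0 : R).
  have : (fun i => r^-1 * (w i phi : R)) @ F --> r^-1 * (0 : R).
    by apply: cvgMl_tmp; exact: w0.
  by rewrite mulr0; apply.
have w't : \forall i \near F, `|w' i| <= t / r.
  by apply: filterS wt => i; rewrite normrZ gtr0_norm ?invr_gt0// mulrC ler_pM2r ?invr_gt0.
have tr0 : 0 < t / r by rewrite divr_gt0.
have er0 : 0 < eta / r by rewrite divr_gt0.
have nearP := weak_star_smooth_sphere (FF := FF) w'0 w't e1 tr0 er0.
have Ne1 : `|- e| = 1 by rewrite normrN.
have nearN := weak_star_smooth_sphere (FF := FF) w'0 w't Ne1 tr0 er0.
apply: filterS2 nearP nearN => i leP leN.
(* [u] is a convex combination of [r e] and [- r e], and the norm is convex. *)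
have [b [c [b0 c0 bcD bcB]]] := ex_sum_diff a0 ar.
have -> : emb u + w i = b *: (emb e + w' i) + c *: (emb (- e) + w' i).
  have -> : emb (- e) = - emb e by rewrite -scaleN1r canonical_embeddingZ scaleN1r.
  rewrite !scalerDr addrACA -scalerDl scalerN -scalerBl bcD bcB.
  by rewrite uE canonical_embeddingZ scalerA mulfV ?scale1r// gt_eqF.
apply: le_trans (norm_conical_le b0 c0 leP leN) _.
by rewrite bcD [leLHS]mulrDr lerD2l mulrC divfK ?gt_eqF.
Qed.

End WeakStarSmoothness.

(** * Limits along an ultrafilter *)

Section UltrafilterLimits.
Context (U : set_system nat) {UU : UltraFilter U}.

(** The image of [U] has a cluster point in a compact segment, and a cluster point of an ultrafilter
    is a limit. *)
Lemma ultra_cvg_bounded (R : realType) (g : nat -> R) (C : R) :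
  (forall n, `|g n| <= C) -> cvg (g @ U).
Proof.
move=> gC.
have gCC : U (g @^-1` `[- C, C]%classic).
  by apply: filterE => n /=; rewrite in_itv/=; have := gC n; rewrite ler_norml.
have [p [_ clp]] := @segment_compact R (- C) C (g @ U) _ gCC.
apply/cvg_ex; exists p => A pA.
have [//|UnA] := in_ultra_setVsetC (g @^-1` A) UU.
by have [x []] := clp (~` A) A UnA pA.
Qed.

Lemma near_all_seq (T : eqType) (s : seq T) (P : T -> nat -> Prop) :
  (forall x, x \in s -> \forall n \near U, P x n) ->
  \forall n \near U, forall x, x \in s -> P x n.
Proof.
elim: s => [|y s IHs] sP; first by apply: filterE.
have Py : \forall n \near U, P y n by apply: sP; rewrite mem_head.
have Ps : \forall n \near U, forall x, x \in s -> P x n.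
  by apply: IHs => x xs; apply: sP; rewrite in_cons xs orbT.
apply: filterS2 Py Ps => n Pyn Psn x; rewrite in_cons => /orP[/eqP->//|].
exact: Psn.
Qed.

Section WeakStarLimits.
Context (R : realType) (Y : normedModType R).
Implicit Types (h : nat -> bidual Y) (x : bidual Y) (C D : R).

Definition wcvg h x := forall phi, (fun n => h n phi : R) @ U --> (x phi : R).

Definition wlim h : bidual Y := xget 0 [set x | wcvg h x].

(** Weak* compactness by hand: the limits along [U] of [h n phi] depend linearly on [phi] and are
    bounded by [C * |phi|], hence define an element of the bidual. *)
Lemma wlimP h C : (forall n, `|h n| <= C) -> wcvg h (wlim h).
Proof.
move=> hC.
have hphi phi n : `|h n phi| <= C * `|phi|.
  by rewrite (le_trans (dual_apply_le _ _))// ler_wpM2r.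
pose g phi : R := lim ((fun n => h n phi : R) @ U).
have gP phi : (fun n => h n phi : R) @ U --> g phi.
  exact: (ultra_cvg_bounded (hphi phi)).
have glin c phi psi : g (c *: phi + psi) = c * g phi + g psi.
  apply: cvg_lim => //.
  have -> : (fun n => h n (c *: phi + psi) : R) = (fun n => c * h n phi + h n psi).
    by apply/funext => n; rewrite linearP.
  by apply: cvgD => //; exact: cvgMl_tmp.
have gC phi : `|g phi| <= C * `|phi|.
  by apply: (cvgr_to_le (cvg_norm (gP phi))); apply: filterE => n; exact: hphi.
have [x xg] := dual_intro glin gC.
suff : wcvg h x by exact: xgetI.
by move=> phi; rewrite xg.
Qed.

Lemma wcvg_cst x : wcvg (fun=> x) x.
Proof. by move=> phi; exact: cvg_cst. Qed.

Arguments wlimP {h C} _.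
Arguments wcvg_cst x : clear implicits.

(** This is weak* lower semicontinuity of the norm, tested on functionals of the unit ball. *)
Lemma wcvg_dist_le h h' x x' D : wcvg h x -> wcvg h' x' ->
  (\forall n \near U, `|h n - h' n| <= D) -> `|x - x'| <= D.
Proof.
move=> hx hx' hD; apply: dual_norm_le => phi phi1.
have hh' : (fun n => h n phi - h' n phi : R) @ U --> (x phi - x' phi : R).
  by apply: cvgB; [exact: hx|exact: hx'].
apply: (cvgr_to_le (cvg_norm hh')).
apply: filterS hD => n; apply: le_trans.
apply: le_trans (dual_apply_le (h n - h' n) phi) _.
by rewrite ler_piMr.
Qed.

End WeakStarLimits.
Arguments wlimP {R Y h C} _.
Arguments wcvg_cst {R Y} x.
Arguments wcvg_dist_le {R Y h h' x x'} D _ _ _.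

(** * Iterated limits and their increments *)

Section IteratedLimits.
Context (R : realType) (Y : normedModType R).
Implicit Types (h : seq nat -> bidual Y) (P : seq nat -> Prop) (C D L : R).

Definition slice (T : Type) (h : seq nat -> T) n : seq nat -> T := fun s => h (n :: s).

(** This is membership in the [k]-fold tensor power of [U]: the set from which each entry is drawn
    may depend on the entries before it. *)
Fixpoint ev k P : Prop :=
  if k is k'.+1 then \forall n \near U, ev k' (slice P n) else P [::].

(** The limit in the last entry is the innermost. Slicing [h] at [n_1], ..., [n_j] and taking the
    remaining [k - j] limits gives [F_j(n_1, ..., n_j)]. *)
Fixpoint itlim k h : bidual Y :=
  if k is k'.+1 then wlim (fun n => itlim k' (slice h n)) else h [::].

Lemma itlim_bound C k h : (forall s, `|h s| <= C) -> `|itlim k h| <= C.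
Proof.
elim: k h => [|k IHk] h hC /=; first exact: hC.
have hkC n : `|itlim k (slice h n)| <= C by apply: IHk => s; exact: hC.
have := wcvg_dist_le C (wlimP hkC) (wcvg_cst 0); rewrite subr0; apply.
by apply: filterE => n; rewrite subr0.
Qed.

Lemma itlimP C k h : (forall s, `|h s| <= C) ->
  wcvg (fun n => itlim k (slice h n)) (itlim k.+1 h).
Proof. by move=> hC; apply: (@wlimP _ _ _ C) => n; apply: itlim_bound => s; exact: hC. Qed.

Arguments itlimP {C} k {h} _.

Lemma itlim_dist_le C D k h h' : (forall s, `|h s| <= C) -> (forall s, `|h' s| <= C) ->
  ev k (fun s => `|h s - h' s| <= D) -> `|itlim k h - itlim k h'| <= D.
Proof.
elim: k h h' => [|k IHk] h h' hC h'C //= evD.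
apply: (wcvg_dist_le _ (itlimP k hC) (itlimP k h'C)).
apply: filterS evD => n; apply: IHk => s; [exact: hC|exact: h'C].
Qed.

(* [level Phi j k h] is the limit of [Phi (itlim (k - j) h(n_1, ..., n_j, -))]
   as [n_j], ..., [n_1] successively tend to [U]. *)
Fixpoint level (Phi : dual (bidual Y)) j k h : R :=
  match j, k with
  | 0, _ => Phi (itlim k h)
  | j'.+1, 0 => 0
  | j'.+1, k'.+1 => lim ((fun n => level Phi j' k' (slice h n)) @ U)
  end.

Lemma level_bound C Phi j k h : 0 <= C -> (forall s, `|h s| <= C) ->
  `|level Phi j k h| <= `|Phi| * C.
Proof.
move=> C0; elim: j k h => [|j IHj] k h hC /=.
  rewrite (le_trans (dual_apply_le _ _))// ler_wpM2l//; exact: itlim_bound.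
case: k => [|k]; first by rewrite normr0 mulr_ge0.
have jC n : `|level Phi j k (slice h n)| <= `|Phi| * C by apply: IHj => s; exact: hC.
apply: (cvgr_to_le (cvg_norm (ultra_cvg_bounded jC))).
by apply: filterE => n; exact: jC.
Qed.

Lemma levelP C Phi j k h : 0 <= C -> (forall s, `|h s| <= C) ->
  (fun n => level Phi j k (slice h n)) @ U --> level Phi j.+1 k.+1 h.
Proof.
move=> C0 hC; have jC n : `|level Phi j k (slice h n)| <= `|Phi| * C.
  by apply: level_bound => // s; exact: hC.
exact: (ultra_cvg_bounded jC).
Qed.

(** Only sequences that differ in a single entry are compared, and only for almost all choices; this
    is what survives when a map on increasing tuples is extended to all lists. *)
Fixpoint ae_lipschitz (L : R) (a : seq R) h : Prop :=
  if a is b :: a' then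
    (\forall n \near U, \forall m \near U,
      ev (size a') (fun s => `|slice h n s - slice h m s| <= L * `|b|)) /\
    \forall n \near U, ae_lipschitz L a' (slice h n)
  else True.

(** This bounds the increments [z_j]: the Lipschitz inequality between slices at [n] and [m] passes
    to the limits, the one in [m] included. *)
Lemma ae_lipschitz_increment C L b a h : (forall s, `|h s| <= C) -> ae_lipschitz L (b :: a) h ->
  \forall n \near U,
    `|itlim (size a) (slice h n) - itlim (size a).+1 h| <= L * `|b|.
Proof.
move=> hC [+ _]; apply: filterS => n lipn.
apply: (wcvg_dist_le _ (wcvg_cst _) (itlimP (size a) hC)).
by apply: filterS lipn => m; apply: itlim_dist_le => s; exact: hC.
Qed.

(** The entries of [s] go alternately to [h] and [h'], in the order [n_1, m_1, n_2, m_2, ...] in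
    which they are chosen, so that one [ev] quantifies over both tuples. *)
Fixpoint interlaced_diff h h' (s : seq nat) : bidual Y :=
  if s is n :: m :: s' then interlaced_diff (slice h n) (slice h' m) s'
  else h [::] - h' [::].

End IteratedLimits.
End UltrafilterLimits.

Arguments itlimP {U UU R Y C} k {h} _.

(** * The norm estimate along interlaced choices *)

Section InterlacedEstimate.
Context (U : set_system nat) {UU : UltraFilter U}.
Context (R : realType) (Y : normedModType R).
Context (ds : seq (dual (bidual Y) * bidual Y)).
Context (dsP : forall v, range (@canonical_embedding R Y) (v - \sum_(p <- ds) p.1 v *: p.2)).
Implicit Types (h : seq nat -> bidual Y) (C L r B delta : R).

(** Level [j] of a slice converges to level [j + 1] of the whole. Strict closeness at the higher
    levels therefore persists, first when [n] is chosen and [h'] is still in the limit, then when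
    [m] is chosen. *)
Lemma level_close C delta k h h' : 0 <= C ->
  (forall s, `|h s| <= C) -> (forall s, `|h' s| <= C) ->
  (forall j p, (j <= k.+1)%N -> p \in ds ->
    `|level U p.1 j k.+1 h - level U p.1 j k.+1 h'| < delta) ->
  \forall n \near U, \forall m \near U, forall j p, (j <= k)%N -> p \in ds ->
    `|level U p.1 j k (slice h n) - level U p.1 j k (slice h' m)| < delta.
Proof.
move=> C0 hC h'C close.
have near1 : \forall n \near U, forall j, j \in iota 0 k.+1 -> forall p, p \in ds ->
    `|level U p.1 j k (slice h n) - level U p.1 j.+1 k.+1 h'| < delta.
  apply: near_all_seq => j; rewrite mem_iota => /andP[_ jk].
  apply: near_all_seq => p pds; apply: cvgr_lt; last exact: (close j.+1 p jk pds).
  by apply: cvg_norm; apply: cvgB; [exact: levelP C0 hC|exact: cvg_cst].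
apply: filterS near1 => n near1.
have : \forall m \near U, forall j, j \in iota 0 k.+1 -> forall p, p \in ds ->
    `|level U p.1 j k (slice h n) - level U p.1 j k (slice h' m)| < delta.
  apply: near_all_seq => j jk; apply: near_all_seq => p pds.
  apply: cvgr_lt; last exact: near1 j jk p pds.
  by apply: cvg_norm; apply: cvgB; [exact: cvg_cst|exact: levelP C0 h'C].
by apply: filterS => m near2 j p jk; apply: near2; rewrite mem_iota.
Qed.

Lemma dist_canonical_range delta (v : bidual Y) :
  (forall p, p \in ds -> `|p.1 v| <= delta) ->
  exists x : Y, `|v - canonical_embedding x| <= delta * \sum_(p <- ds) `|p.2|.
Proof.
move=> vd; have [x _ xE] := dsP v; exists x.
rewrite xE opprB addrC subrK (le_trans (ler_norm_sum _ _ _))//.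
rewrite mulr_sumr big_seq [leRHS]big_seq ler_sum// => p pds.
by rewrite normrZ ler_wpM2r// vd.
Qed.

(** The difference of the two increments is weak* null along the product filter and has norm at most
    [2 * t], while [H - H'] is replaced by the nearby [x]. The errors are one [eta] in the radius,
    one from smoothness and one from [x]. *)
Lemma one_step_estimate (t r eta : R) (x : Y) (h h' : nat -> bidual Y) (H H' : bidual Y) :
  0 < t -> 0 < r -> 0 < eta -> wcvg U h H -> wcvg U h' H' ->
  (\forall n \near U, `|h n - H| <= t) ->
  (\forall n \near U, `|h' n - H'| <= t) ->
  `|H - H' - canonical_embedding x| <= eta -> `|H - H'| <= r ->
  \forall n \near U, \forall m \near U,
    `|h n - h' m| <= (r + eta) * (1 + rho_bar Y (2 * t / (r + eta))) + 2 * eta.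
Proof.
move=> t0 r0 eta0 hH hH' nearh nearh' xeta Hr.
pose w (nm : nat * nat) := (h nm.1 - H) - (h' nm.2 - H').
have w0 phi : (fun nm => w nm phi : R) @ filter_prod U U --> (0 : R).
  have w1 : (fun nm : nat * nat => h nm.1 phi - H phi : R) @ filter_prod U U -->
      (H phi - H phi : R).
    by apply: cvgB; [exact: cvg_comp cvg_fst (hH phi)|exact: cvg_cst].
  have w2 : (fun nm : nat * nat => h' nm.2 phi - H' phi : R) @ filter_prod U U -->
      (H' phi - H' phi : R).
    by apply: cvgB; [exact: cvg_comp cvg_snd (hH' phi)|exact: cvg_cst].
  by have := cvgB w1 w2; rewrite !subrr; apply.
have wt : \forall nm \near filter_prod U U, `|w nm| <= 2 * t.
  exists ([set n | `|h n - H| <= t], [set n | `|h' n - H'| <= t]) => //.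
  move=> [n m] [/= hn hm]; rewrite (le_trans (ler_normB _ _))//.
  by rewrite mulr2n mulrDl mul1r lerD.
have xr : `|x| <= r + eta.
  rewrite -canonical_embedding_isometry -[canonical_embedding x](subKr (H - H')).
  by rewrite (le_trans (ler_normB _ _))// lerD.
have re0 : 0 < r + eta by rewrite addr_gt0.
have t20 : 0 < 2 * t by rewrite mulr_gt0.
have [[A A'] /= [UA UA'] AA'] := weak_star_smooth w0 wt xr re0 t20 eta0.
apply: filterS UA => n An; apply: filterS UA' => m Am.
have := AA' (n, m) (conj An Am); rewrite /= => wle.
have -> : h n - h' m = (canonical_embedding x + w (n, m)) + (H - H' - canonical_embedding x).
  by rewrite [RHS]addrC subrKA /w/= opprB [RHS]addrACA subrKC addKr.
rewrite (le_trans (ler_normD _ _))// (le_trans (lerD wle xeta))//.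
by rewrite [2 * eta]mulr_natl mulr2n addrA.
Qed.

Lemma ev_mono k (P Q : seq nat -> Prop) : (forall s, P s -> Q s) -> ev U k P -> ev U k Q.
Proof.
elim: k P Q => [|k IHk] P Q PQ /=; first exact: PQ.
by apply: filterS => n; apply: IHk => s; exact: PQ.
Qed.

(** Every factor uses the initial radius [r]: later radii are larger, and [rho_bar] is
    nondecreasing. *)
Definition orlicz_product L r (a : seq R) := \prod_(b <- a) (1 + rho_bar Y (2 * L * `|b| / r)).

Lemma orlicz_product_gt0 L r a : 0 <= L -> 0 < r -> 0 < orlicz_product L r a.
Proof.
move=> L0 r0; apply: prodr_gt0 => b _; rewrite ltr_pwDl// rho_bar_ge0//.
by rewrite divr_ge0 ?mulr_ge0// ltW.
Qed.

(** Induction on [a], with [q] the current bound on the difference of iterated limits; a pair [n],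
    [m] multiplies it by little more than [1 + rho]. The tolerance [delta] precedes the maps, so the
    induction hypothesis serves all their slices at once. *)
Lemma interlaced_estimate L r (a : seq R) : 0 < L -> 0 < r -> all (fun b => b != 0) a ->
  forall q B, r <= q -> q * orlicz_product L r a < B ->
  exists2 delta, 0 < delta & forall C h h', 0 <= C ->
    (forall s, `|h s| <= C) -> (forall s, `|h' s| <= C) ->
    ae_lipschitz U L a h -> ae_lipschitz U L a h' ->
    `|itlim U (size a) h - itlim U (size a) h'| <= q ->
    (forall j p, (j <= size a)%N -> p \in ds ->
      `|level U p.1 j (size a) h - level U p.1 j (size a) h'| < delta) ->
    ev U (size a).*2 (fun s => `|interlaced_diff h h' s| <= B).
Proof.
move=> L0 r0; elim: a => [|b a IHa] /=.
  move=> _ q B rq; rewrite /orlicz_product big_nil mulr1 => qB.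
  by exists 1 => // C h h' _ _ _ _ _ hq _ /=; rewrite (le_trans hq)// ltW.
move=> /andP[b0 a0] q B rq; rewrite /orlicz_product big_cons mulrA.
rewrite -/(orlicz_product L r a); set rho := rho_bar Y _ => qB.
have P0 := orlicz_product_gt0 a (ltW L0) r0.
have t0 : 0 < L * `|b| by rewrite mulr_gt0 ?normr_gt0.
have rho0 : 0 <= rho by rewrite rho_bar_ge0// divr_ge0 ?mulr_ge0// ltW.
have q0 : 0 < q by rewrite (lt_le_trans r0).
(* The strict inequality on [B] leaves room for a radius [q1], the bound after the next pair. *)
have [q1 [qq1 q1B]] : exists q1, q * (1 + rho) < q1 /\ q1 * orlicz_product L r a < B.
  rewrite -ltr_pdivlMr// in qB.
  exists ((q * (1 + rho) + B / orlicz_product L r a) / 2).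
  have [mid1 mid2] := midf_lt qB.
  by split => //; rewrite -ltr_pdivlMr.
have rq1 : r <= q1.
  by rewrite (le_trans rq)// ltW// (le_lt_trans _ qq1)// ler_peMr ?lerDl// ltW.
have [delta1 delta1_gt0 IH] := IHa a0 q1 B rq1 q1B.
pose K := \sum_(p <- ds) `|p.2|.
have K0 : 0 <= K by exact: sumr_ge0.
have rho3 : 0 < 3 + rho by rewrite ltr_pwDl.
(* The errors of one step add up to [eta * (3 + rho)], exactly the gap to [q1]. *)
pose eta := (q1 - q * (1 + rho)) / (3 + rho).
have eta0 : 0 < eta by rewrite divr_gt0// subr_gt0.
have K1 : 0 < K + 1 by rewrite ltr_wpDl.
exists (Num.min delta1 (eta / (K + 1))); first by rewrite lt_min delta1_gt0 divr_gt0.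
move=> C h h' C0 hC h'C hL h'L hq close.
(* Level [0] is the functional at the iterated limit itself, so closeness there puts the difference
   near [Y]; [K + 1] instead of [K] avoids a zero divisor. *)
have [x xeta] : exists x : Y, `|itlim U (size a).+1 h - itlim U (size a).+1 h' -
    canonical_embedding x| <= eta.
  have [p pds|x xle] := @dist_canonical_range (eta / (K + 1))
      (itlim U (size a).+1 h - itlim U (size a).+1 h').
    have := close 0 p isT pds; rewrite /= -linearB lt_min => /andP[_ /ltW]; exact.
  exists x; rewrite (le_trans xle)// -/K mulrAC ler_pdivrMr//.
  by rewrite ler_wpM2l ?ltW// ltrDl.
have step := one_step_estimate t0 q0 eta0 (itlimP (size a) hC) (itlimP (size a) h'C)
  (ae_lipschitz_increment hC hL) (ae_lipschitz_increment h'C h'L) xeta hq.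
have lev : \forall n \near U, \forall m \near U,
    forall j p, (j <= size a)%N -> p \in ds ->
    `|level U p.1 j (size a) (slice h n) - level U p.1 j (size a) (slice h' m)| < delta1.
  apply: (level_close C0 hC h'C) => j p jk pds.
  by have := close j p jk pds; rewrite lt_min => /andP[].
have [_ hL1] := hL; have [_ h'L1] := h'L.
apply: filterS3 hL1 (step UU UU UU UU) lev => n hLn stepn levn.
apply: filterS3 h'L1 stepn levn => m h'Lm stepm levm.
apply: (IH C) => // [s|s|]; [exact: hC|exact: h'C|].
apply: (le_trans stepm).
have rho_le : rho_bar Y (2 * (L * `|b|) / (q + eta)) <= rho.
  have qe0 : 0 < q + eta by rewrite addr_gt0.
  rewrite /rho -[2 * L * _]mulrA; apply: rho_bar_mono.
    by rewrite divr_ge0 ?mulr_ge0// ltW.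
  have t20 : 0 < 2 * (L * `|b|) by rewrite mulr_gt0.
  rewrite (ler_pM2l t20) lef_pV2 ?posrE//.
  by rewrite (le_trans rq)// lerDl ltW.
apply: (@le_trans _ _ ((q + eta) * (1 + rho) + 2 * eta)).
  by rewrite lerD2r ler_wpM2l ?lerD2l// ltW// addr_gt0.
have -> : (q + eta) * (1 + rho) + 2 * eta = q * (1 + rho) + eta * (3 + rho) by ring.
by rewrite /eta divfK ?gt_eqF// addrC subrK.
Qed.

End InterlacedEstimate.

(** * From iterated limits to an infinite subset *)

Section DiagonalArgument.
Context (U : set_system nat) {UU : UltraFilter U}.
Context (M : set nat) (UM : U M) (Ufree : forall N, U [set n | (N < n)%N]).

Lemma subseq_rconsP (s p : seq nat) y : subseq s (rcons p y) ->
  subseq s p \/ exists2 s', s = rcons s' y & subseq s' p.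
Proof.
case/lastP: s => [|s z]; first by left; rewrite sub0seq.
rewrite -subseq_rev !rev_rcons /=; case: eqP => [->|_] sub.
  by right; exists s => //; rewrite -subseq_rev.
by left; rewrite -subseq_rev rev_rcons.
Qed.

(** A finite list has finitely many sublists, enumerated by boolean masks, so a single [x] extends
    all those that satisfy [Q]. *)
Lemma next_element (Q : seq nat -> Prop) :
  (forall s, Q s -> \forall n \near U, Q (rcons s n)) ->
  forall xs : seq nat, exists x, [/\ M x, forall y, y \in xs -> (y < x)%N &
    forall s, subseq s xs -> Q s -> Q (rcons s x)].
Proof.
move=> Qstep xs.
have near1 : \forall n \near U, forall y, y \in xs -> (y < n)%N.
  by apply: near_all_seq => y _; exact: Ufree.
have near2 : \forall n \near U, forall m : (size xs).-tuple bool,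
    Q (mask m xs) -> Q (rcons (mask m xs) n).
  apply: filter_forall => m.
  have [Qm|nQm] := pselect (Q (mask m xs)); last by apply: filterE => n /nQm.
  by apply: filterS (Qstep _ Qm).
have [x [Mx [x1 x2]]] := filter_ex (filterI UM (filterI near1 near2)).
exists x; split => // s /subseqP[m /eqP mE ->].
exact: (x2 (Tuple mE)).
Qed.

(** Elements are added one at a time, each compatible with every sublist of its predecessors; an
    increasing list of chosen elements is a sublist of some prefix [pre n]. *)
Lemma diagonal_extraction (Q : seq nat -> Prop) : Q [::] ->
  (forall s, Q s -> \forall n \near U, Q (rcons s n)) ->
  exists M', [/\ infinite_set M', M' `<=` M &
    forall s, sorted ltn s -> (forall x, x \in s -> M' x) -> Q s].
Proof.
move=> Q0 Qstep; have [next nextP] := choice (next_element Qstep).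
pose pre := fix pre n := if n is n'.+1 then rcons (pre n') (next (pre n')) else [::].
pose x n := next (pre n).
have x_pre i j : (i < j)%N -> x i \in pre j.
  elim: j => // j IHj; rewrite ltnS leq_eqVlt mem_rcons in_cons => /orP[/eqP->|/IHj->].
    by rewrite eqxx.
  by rewrite orbT.
have pre_mono i j v : (i <= j)%N -> v \in pre i -> v \in pre j.
  elim: j => [|j IHj]; first by rewrite leqn0 => /eqP->.
  rewrite leq_eqVlt => /orP[/eqP->//|ij vi].
  by rewrite mem_rcons in_cons IHj ?orbT.
have x_mono i j : (i < j)%N -> (x i < x j)%N.
  by move=> ij; have [_ + _] := nextP (pre j); apply; exact: x_pre.
have preQ n s : subseq s (pre n) -> Q s.
  elim: n s => [|n IHn] s; first by rewrite subseq0 => /eqP->.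
  case/subseq_rconsP => [/IHn//|[s' -> sub]].
  by have [_ _] := nextP (pre n); apply => //; exact: IHn.
have pre_sorted n : sorted ltn (pre n).
  elim: n => // n IHn; rewrite sorted_pairwise; last exact: ltn_trans.
  rewrite /= pairwise_rcons -sorted_pairwise ?IHn ?andbT; last exact: ltn_trans.
  by apply/allP => y yn; have [_ + _] := nextP (pre n); apply.
exists (range x); split.
- have x_inj : {in setT &, injective x}.
    move=> i j _ _ xij; apply: contrapT => /eqP.
    by rewrite neq_ltn => /orP[]/x_mono; rewrite xij ltnn.
  by rewrite (eq_finite_set (inj_card_eq x_inj)); exact: infinite_nat.
- by move=> _ [n _ <-]; have [] := nextP (pre n).
- move=> s s_sorted sx.
  have [n sn] : exists n, forall v, v \in s -> v \in pre n.
    elim: s {s_sorted} sx => [|v s IHs] sx; first by exists 0.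
    have [n sn] : exists n, forall v, v \in s -> v \in pre n.
      by apply: IHs => u us; apply: sx; rewrite in_cons us orbT.
    have [i _ xi] := sx v (mem_head _ _).
    exists (maxn n i.+1) => u; rewrite in_cons => /orP[/eqP->|/sn].
      by rewrite -xi x_pre// leq_max leqnn orbT.
    by apply: pre_mono; rewrite leq_max leqnn.
  apply: (preQ n).
  have -> : s = [seq v <- pre n | v \in s].
    apply: (irr_sorted_eq ltn_trans ltnn) => //.
      exact: (sorted_filter ltn_trans).
    by move=> v; rewrite mem_filter /=; case vs: (v \in s) => //=; rewrite sn.
  exact: filter_subseq.
Qed.

End DiagonalArgument.

(** The tails of the infinite set [M] generate a proper filter, which an ultrafilter refines. *)
Lemma free_ultrafilter (M : set nat) : infinite_set M ->
  exists U : set_system nat, [/\ UltraFilter U, U M &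
    forall N, U [set n | (N < n)%N]].
Proof.
move=> infM.
pose F := filter_from [set: nat] (fun N => M `&` [set n | (N < n)%N]).
have FF : ProperFilter F.
  apply: filter_from_proper.
    apply: filter_from_filter; first by exists 0%N.
    move=> i j _ _; exists (maxn i j) => // n [Mn] /=.
    by rewrite gtn_max => /andP[ni nj].
  move=> N _; apply: contrapT => empty; apply: infM.
  apply: (@sub_finite_set _ _ `I_N.+1) => // n Mn /=.
  by rewrite ltnS leqNgt; apply/negP => Nn; apply: empty; exists n.
have [U [UU FU]] := ultraFilterLemma FF.
exists U; split => // [|N]; apply: FU.
  by exists 0%N => // n [].
by exists N => // n [].
Qed.

(** The predicate says that [s] can almost surely be completed to a list of length [K] in [P]. It is
    vacuous for longer lists, so it propagates at every length, as the diagonal argument demands. *)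
Lemma ev_cat_rcons (U : set_system nat) {UU : UltraFilter U} K (P : seq nat -> Prop) s :
  ((size s <= K)%N -> ev U (K - size s) (fun s' => P (s ++ s'))) ->
  \forall n \near U,
    ((size (rcons s n) <= K)%N -> ev U (K - size (rcons s n)) (fun s' => P (rcons s n ++ s'))).
Proof.
move=> evs; have [sK|Ks] := ltnP (size s) K; last first.
  by apply: filterE => n; rewrite size_rcons leqNgt ltnS Ks.
have := evs (ltnW sK); rewrite -(subnSK sK) /=.
apply: filterS => n evn _; rewrite size_rcons.
by apply: ev_mono evn => s'; rewrite cat_rcons.
Qed.

Lemma ev_extraction (U : set_system nat) {UU : UltraFilter U} (M : set nat) K
    (P : seq nat -> Prop) :
  U M -> (forall N, U [set n | (N < n)%N]) -> ev U K P ->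
  exists M', [/\ infinite_set M', M' `<=` M &
    forall s, size s = K -> sorted ltn s -> (forall x, x \in s -> M' x) -> P s].
Proof.
move=> UM Ufree evP.
pose Q s := (size s <= K)%N -> ev U (K - size s) (fun s' => P (s ++ s')).
have Q0 : Q [::] by move=> _; rewrite subn0.
have [M' [infM' M'M M'Q]] := diagonal_extraction UM Ufree Q0 (@ev_cat_rcons U UU K P).
exists M'; split => // s sK s_sorted sM'.
by have := M'Q s s_sorted sM'; rewrite /Q sK subnn leqnn /= cats0; apply.
Qed.

Fixpoint interleave (s t : seq nat) : seq nat :=
  if s is x :: s' then if t is y :: t' then x :: y :: interleave s' t' else [::] else [::].

Lemma size_interleave s t : size s = size t -> size (interleave s t) = (size s).*2.
Proof. by elim: s t => [|x s IHs] [|y t] //= [/IHs->]. Qed.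

Lemma mem_interleave s t v : v \in interleave s t -> v \in s \/ v \in t.
Proof.
elim: s t => [|x s IHs] [|y t] //=; rewrite !in_cons.
by move=> /or3P[->|->|/IHs[]->]; rewrite ?orbT; [left|right|left|right].
Qed.

Lemma sorted_interleave s t : size s = size t ->
  (forall i, (i < size s)%N -> (nth 0 s i < nth 0 t i)%N) ->
  (forall i, (i.+1 < size s)%N -> (nth 0 t i < nth 0 s i.+1)%N) ->
  sorted ltn (interleave s t).
Proof.
elim: s t => [|x s IHs] [|y t] //= [st] lt1 lt2; rewrite (lt1 0%N)//=.
have := IHs t st (fun i => lt1 i.+1) (fun i => lt2 i.+1).
case: s t st lt1 lt2 {IHs} => [|x' s] [|y' t] //= _ lt1 lt2 ->.
by rewrite (lt2 0%N).
Qed.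

Lemma interlaced_diff_interleave (R : realType) (Y : normedModType R)
    (h h' : seq nat -> bidual Y) s t : size s = size t ->
  interlaced_diff h h' (interleave s t) = h s - h' t.
Proof. by elim: s t h h' => [|x s IHs] [|y t] h h' //= [/IHs->]. Qed.

(** * Lipschitz maps on increasing tuples *)

Section LipschitzMaps.
Context (R : realType) (Y : normedModType R) (k : nat) (a : k.-tuple R) (M : set nat).
Context (f : k.-tuple nat -> bidual Y).
Context (lipf : is_lipschitz (Gk M) (dist_a a) f).
Local Notation L := (Lip (Gk M) (dist_a a) f).

Lemma dist_a_ge0 n m : 0 <= dist_a a n m.
Proof. by apply: sumr_ge0 => j _. Qed.

Lemma Lip_ge0 : 0 <= L.
Proof. by apply: lb_le_inf => // K []. Qed.

Lemma LipP n m : Gk M n -> Gk M m -> `|f n - f m| <= L * dist_a a n m.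
Proof.
move=> Gn Gm; have := dist_a_ge0 n m; rewrite le_eqVlt => /orP[/eqP d0|d0].
  (* At distance [0] one cannot divide, but any Lipschitz constant makes the left side [0]. *)
  by have [K [_ KP]] := lipf; rewrite -d0 mulr0 (le_trans (KP _ _ Gn Gm))// -d0 mulr0.
rewrite -ler_pdivrMr//; apply: lb_le_inf => // K [_ KP].
by rewrite ler_pdivrMr// KP.
Qed.

(* With the value [0] off [Gk M] the map is bounded on all sequences, so that its iterated weak*
   limits exist without side conditions. *)
Definition extend_zero (s : seq nat) : bidual Y :=
  if insub s is Some t then (if `[< Gk M t >] then f t else 0) else 0.

Lemma extend_zeroE (t : k.-tuple nat) : Gk M t -> extend_zero t = f t.
Proof. by move=> Gt; rewrite /extend_zero valK asboolT. Qed.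

(** The metric [dist_a] is at most the sum of all [|a_j|], so a Lipschitz map is bounded. *)
Lemma extend_zero_bounded : exists2 C, 0 <= C & forall s, `|extend_zero s| <= C.
Proof.
have [[t0 Gt0]|nG] := pselect (exists t : k.-tuple nat, Gk M t); last first.
  exists 0 => // s; rewrite /extend_zero.
  case: (insub s : option (k.-tuple nat)) => [t|]; last by rewrite normr0.
  by case: asboolP => [Gt|_]; [case: nG; exists t|rewrite normr0].
exists (L * \sum_j `|tnth a j| + `|f t0|).
  by rewrite addr_ge0// mulr_ge0 ?Lip_ge0// sumr_ge0.
have C0 : 0 <= L * \sum_j `|tnth a j| + `|f t0|.
  by rewrite addr_ge0// mulr_ge0 ?Lip_ge0// sumr_ge0.
move=> s; rewrite /extend_zero.
case: (insub s : option (k.-tuple nat)) => [t|]; last by rewrite normr0.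
case: asboolP => [Gt|_]; last by rewrite normr0.
rewrite -[f t](subrK (f t0)) (le_trans (ler_normD _ _))// lerD2r.
rewrite (le_trans (LipP Gt Gt0))// ler_wpM2l ?Lip_ge0// /dist_a big_mkcond ler_sum// => j _.
by case: ifP.
Qed.

Lemma Gk_tuple (s : seq nat) : size s = k -> sorted ltn s -> (forall x, x \in s -> M x) ->
  exists2 t : k.-tuple nat, tval t = s & Gk M t.
Proof.
move=> /eqP sk s_sorted sM; exists (Tuple sk) => //; split=> // i.
by apply: sM; rewrite mem_tnth.
Qed.

Lemma extend_zero_dist p x y s b : size (p ++ x :: s) = k ->
  drop (size p) a = b :: drop (size p).+1 a ->
  sorted ltn (p ++ x :: s) -> sorted ltn (p ++ y :: s) ->
  (forall z, z \in p ++ x :: s -> M z) -> (forall z, z \in p ++ y :: s -> M z) ->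
  `|extend_zero (p ++ x :: s) - extend_zero (p ++ y :: s)| <= L * `|b|.
Proof.
move=> sk ab sx sy Mx My.
have sk' : size (p ++ y :: s) = k by rewrite -sk !size_cat.
have [t tE Gt] := Gk_tuple sk sx Mx; have [u uE Gu] := Gk_tuple sk' sy My.
rewrite -tE -uE !extend_zeroE// (le_trans (LipP Gt Gu))// ler_wpM2l ?Lip_ge0//.
have pk : (size p < k)%N by rewrite -sk size_cat /= addnS ltnS leq_addr.
have -> : b = tnth a (Ordinal pk).
  by have := congr1 (head 0) ab; rewrite -nth0 nth_drop addn0 (tnth_nth 0) => ->.
have <- : \sum_(j < k | j == Ordinal pk) `|tnth a j| = `|tnth a (Ordinal pk)|.
  by rewrite big_pred1_eq.
rewrite /dist_a big_mkcond [leRHS]big_mkcond ler_sum// => j _.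
rewrite !(tnth_nth 0%N) tE uE.
case: eqP => [_|neq] /=; first by case: ifP.
case: ifPn => // jp; case: neq; rewrite !nth_cat.
case: ltnP => // pj; case jpE : (j - size p)%N => [|i] //.
by case/eqP: jp; apply: val_inj; apply/eqP; rewrite eqn_leq pj -subn_eq0 jpE.
Qed.

Context (U : set_system nat) {UU : UltraFilter U}.
Context (UM : U M) (Ufree : forall N, U [set n | (N < n)%N]).

Lemma ev_increasing j N :
  ev U j (fun s => [/\ size s = j, path ltn N s & forall x, x \in s -> M x]).
Proof.
elim: j N => [|j IHj] N //=.
apply: filterS2 UM (Ufree N) => n Mn Nn.
apply: ev_mono (IHj n) => s [sj ns sM]; split => /=; [by rewrite sj|by rewrite Nn|].
by move=> x; rewrite in_cons => /orP[/eqP->//|/sM].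
Qed.

(** The induction on the remaining weights [b] keeps the entries already chosen in [p], since
    membership in [Gk M] concerns the whole list. *)
Lemma ae_lipschitz_extend_zero_prefix p b : drop (size p) a = b ->
  (size p + size b)%N = k -> sorted ltn p -> (forall x, x \in p -> M x) ->
  ae_lipschitz U L b (fun s => extend_zero (p ++ s)).
Proof.
elim: b p => [|b0 b IHb] p //= ab pk sp Mp.
have near_p : \forall n \near U, M n /\ forall x, x \in p -> (x < n)%N.
  apply: filterI UM _; apply: near_all_seq => x _; exact: Ufree.
have dropS : drop (size p).+1 a = b by rewrite -addn1 addnC -drop_drop ab /= drop0.
have cat_sorted n s : (forall x, x \in p -> (x < n)%N) -> path ltn n s ->
    sorted ltn (p ++ n :: s).
  move=> pn ns; rewrite sorted_pairwise; last exact: ltn_trans.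
  rewrite pairwise_cat -!sorted_pairwise; [|exact: ltn_trans..].
  rewrite sp /= ns !andbT; apply/allrelP => x y xp; rewrite in_cons => /orP[/eqP->|ys].
    exact: pn.
  apply: ltn_trans (pn _ xp) _.
  by move: ns; rewrite (path_sortedE ltn_trans) => /andP[/allP/(_ _ ys)].
split.
  apply: filterS (near_p) => n [Mn pn]; apply: filterS (near_p) => m [Mm pm].
  (* The tail starts beyond both [n] and [m], so it completes either choice to an increasing
     tuple. *)
  apply: ev_mono (ev_increasing (size b) (maxn n m)) => s [sb nms sM].
  have path_le i : (i <= maxn n m)%N -> path ltn i s.
    move=> im; move: nms; rewrite !(path_sortedE ltn_trans) => /andP[/allP nms ->].
    by rewrite andbT; apply/allP => x xs; apply: leq_ltn_trans im (nms _ xs).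
  have cat_M i x : M i -> x \in p ++ i :: s -> M x.
    by move=> Mi; rewrite mem_cat in_cons => /or3P[/Mp|/eqP->|/sM].
  apply: extend_zero_dist.
  - by rewrite size_cat /= sb.
  - by rewrite ab dropS.
  - by apply: cat_sorted => //; apply: path_le; rewrite leq_maxl.
  - by apply: cat_sorted => //; apply: path_le; rewrite leq_maxr.
  - by move=> x; exact: cat_M.
  - by move=> x; exact: cat_M.
apply: filterS (near_p) => n [Mn pn].
have -> : slice (fun s => extend_zero (p ++ s)) n = (fun s => extend_zero (rcons p n ++ s)).
  by apply/funext => s; rewrite cat_rcons.
apply: IHb.
- by rewrite size_rcons.
- by rewrite size_rcons addSnnS.
- by rewrite -cats1; exact: cat_sorted.
- by move=> x; rewrite mem_rcons in_cons => /orP[/eqP->|/Mp].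
Qed.

Lemma ae_lipschitz_extend_zero : ae_lipschitz U L a extend_zero.
Proof. by apply: (@ae_lipschitz_extend_zero_prefix [::]); rewrite ?drop0 ?size_tuple. Qed.

Lemma interlaced_extend_zero B :
  ev U k.*2 (fun s => `|interlaced_diff extend_zero extend_zero s| <= B) ->
  exists M' : set nat, [/\ infinite_set M', M' `<=` M &
    forall n m, Ik M' (n, m) -> `|f n - f m| <= B].
Proof.
move=> /(ev_extraction UM Ufree)[M' [infM' M'M M'B]]; exists M'; split => // n m.
case=> /= [[sn nM'] [sm mM'] nm mn].
have sz : size n = size m by rewrite !size_tuple.
have Gn : Gk M n by split => // i; exact: M'M.
have Gm : Gk M m by split => // i; exact: M'M.
have -> : f n - f m = interlaced_diff extend_zero extend_zero (interleave n m).
  by rewrite interlaced_diff_interleave// !extend_zeroE.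
apply: M'B; first by rewrite size_interleave// size_tuple.
  apply: sorted_interleave => // i; rewrite size_tuple => ik.
    by rewrite -!(tnth_nth 0%N _ (Ordinal ik)).
  have ik' := ltnW ik.
  by rewrite -(tnth_nth 0%N _ (Ordinal ik)) -(tnth_nth 0%N _ (Ordinal ik')) mn.
by move=> x /mem_interleave[]/tnthP[i ->].
Qed.

End LipschitzMaps.

(** * The Orlicz norm and the conclusion *)

Lemma orlicz_sum_le (R : realType) (rho : R -> R) (a : seq R) (s : R) :
  (forall t, 0 <= t -> 0 <= rho t) -> 0 < s ->
  (\sum_(0 <= n <oo) (rho (`|nth 0 a n| / s))%:E <= 1)%E ->
  \sum_(b <- a) rho (`|b| / s) <= 1.
Proof.
move=> rho0 s0 le1; rewrite (big_nth 0) -lee_fin -sumEFin; apply: le_trans le1.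
by apply: nneseries_lim_ge => n _ _; rewrite lee_fin rho0// divr_ge0// ltW.
Qed.

(** The radius [2 * L * s] cancels the factor [2 * L]; then [1 + x <= expR x] turns the product into
    the exponential of a sum at most [1]. *)
Lemma orlicz_product_le (R : realType) (Y : normedModType R) (L s : R) (a : seq R) :
  0 < L -> 0 < s -> \sum_(b <- a) rho_bar Y (`|b| / s) <= 1 ->
  orlicz_product Y L (2 * L * s) a <= expR 1.
Proof.
move=> L0 s0 le1; apply: (@le_trans _ _ (expR (\sum_(b <- a) rho_bar Y (`|b| / s)))); last first.
  by rewrite ler_expR.
rewrite /orlicz_product; elim: a {le1} => [|b a IHa]; first by rewrite !big_nil expR0.
rewrite !big_cons expRD.
have L20 : 2 * L != 0 by rewrite gt_eqF// mulr_gt0.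
have -> : 2 * L * `|b| / (2 * L * s) = `|b| / s by rewrite -mulf_div divff// mul1r.
have rho0 : 0 <= rho_bar Y (`|b| / s) by rewrite rho_bar_ge0// divr_ge0// ltW.
apply: ler_pM => //; first by rewrite addr_ge0.
  by rewrite ltW// (orlicz_product_gt0 _ _ (ltW L0))// mulr_gt0// mulr_gt0.
exact: expR_ge1Dx.
Qed.

(** Without admissible [s] the infimum is [+oo]; otherwise it is finite and is approached within
    [eps / c]. *)
Lemma orlicz_norm_approx (R : realType) (rho : R -> R) (x : R^nat) (c eps : R) :
  0 < c -> 0 < eps ->
  (c%:E * orlicz_norm rho x = +oo)%E \/
  exists s : R, [/\ 0 < s, (\sum_(0 <= n <oo) (rho (`|x n| / s))%:E <= 1)%E &
    ((c * s)%:E <= c%:E * orlicz_norm rho x + eps%:E)%E].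
Proof.
move=> c0 eps0; rewrite /orlicz_norm; set S := [set _ | _ in _].
have [->|/set0P[_ [s0 Ss0 _]]] := eqVneq S set0.
  by left; rewrite ereal_inf0 gt0_muley ?lte_fin.
have inf_ge0 : (0 <= ereal_inf S)%E.
  by apply: le_ereal_inf_tmp => _ [s [s_gt0 _] <-]; rewrite lee_fin ltW.
have inf_fin : ereal_inf S \is a fin_num.
  rewrite ge0_fin_numE//; apply: (@le_lt_trans _ _ s0%:E); last exact: ltry.
  by apply: ereal_inf_lbound; exists s0.
have ec0 : 0 < eps / c by rewrite divr_gt0.
have [_ [s [s_gt0 sle1] <-] slt] := lb_ereal_inf_adherent ec0 inf_fin.
right; exists s; split => //.
rewrite -(fineK inf_fin) -EFinM -EFinD lee_fin.
move: slt; rewrite -(fineK inf_fin) -EFinD lte_fin => slt.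
by rewrite -[leRHS]/(_ + eps) -ler_pdivlMl// mulrDr mulKf ?gt_eqF// mulrC ltW// mulrC.
Qed.

Theorem theorem2p4 (R : realType) (Y : completeNormedModType R)
    (k : nat) (a : k.-tuple R) (M : set nat) (f : k.-tuple nat -> bidual Y) :
  quasi_reflexive Y ->
  (forall j, tnth a j != 0) ->
  infinite_set M ->
  is_lipschitz (Gk M) (dist_a a) f ->
  forall eps : R, 0 < eps ->
  exists M' : set nat, [/\ infinite_set M', M' `<=` M &
    forall n m, Ik M' (n, m) ->
      (`|f n - f m|%:E <=
        (2 * expR 1 * Lip (Gk M) (dist_a a) f)%:E *
          orlicz_norm (rho_bar Y) (zero_extension a) + eps%:E)%E].
Proof.
move=> qrY a0 infM lipf eps eps0.
have L0 := Lip_ge0 lipf; set L := Lip _ _ _ in L0 *.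
(* If [L = 0], then [f] is constant on [Gk M], and the product with a possibly infinite norm is [0]
   by convention. *)
have [L_eq0|L_neq0] := eqVneq L 0.
  exists M; split => // n m [/= Gn Gm _ _].
  rewrite L_eq0 mulr0 mul0e add0e lee_fin (le_trans (LipP lipf Gn Gm))//.
  by rewrite -/L L_eq0 mul0r ltW.
have L_gt0 : 0 < L by rewrite lt_def L_neq0.
have c_gt0 : 0 < 2 * expR 1 * L by rewrite !mulr_gt0 ?expR_gt0.
have eps2 : 0 < eps / 2 by rewrite divr_gt0.
have [->|[s [s_gt0 s_le1 s_approx]]] :=
  orlicz_norm_approx (rho_bar Y) (zero_extension a) c_gt0 eps2.
  by exists M; split => // n m _; rewrite addye// leey.
have [U [UU UM Ufree]] := free_ultrafilter infM.
have [C C0 fC] := extend_zero_bounded lipf.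
have [ds dsP] := finite_codim_decomposition (@canonical_range_closed R Y)
  (canonical_range_submod Y) qrY.
have r_gt0 : 0 < 2 * L * s by rewrite !mulr_gt0.
have a_neq0 : all (fun b => b != 0) a by apply/allP => b /tnthP[j ->].
have sum_le1 := orlicz_sum_le (@rho_bar_ge0 R Y) s_gt0 s_le1.
pose B := 2 * expR 1 * L * s + eps / 2.
have rB : 2 * L * s * orlicz_product Y L (2 * L * s) a < B.
  apply: (@le_lt_trans _ _ (2 * L * s * expR 1)).
    by rewrite ler_wpM2l ?(ltW r_gt0)// orlicz_product_le.
  have -> : 2 * L * s * expR 1 = 2 * expR 1 * L * s by ring.
  by rewrite /B ltrDl.
(* The recursion starts with [q = r = 2 * L * s] and the same map twice, so the differences of
   iterated limits and of levels are all [0]. *)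
have [delta delta0 est] := interlaced_estimate dsP L_gt0 r_gt0 a_neq0 (lexx _) rB.
have lip_ext : ae_lipschitz U L a (extend_zero M f) by exact: ae_lipschitz_extend_zero.
have := est C _ _ C0 fC fC lip_ext lip_ext.
rewrite subrr normr0 => /(_ (ltW r_gt0)) => evB.
have {evB} : ev U k.*2 (fun s => `|interlaced_diff (extend_zero M f) (extend_zero M f) s| <= B).
  by rewrite -[k in k.*2](size_tuple a); apply: evB => j p _ _; rewrite subrr normr0.
move=> /(interlaced_extend_zero UM Ufree)[M' [infM' M'M M'B]].
exists M'; split => // n m nm; apply: (@le_trans _ _ B%:E); first by rewrite lee_fin M'B.
rewrite /B EFinD [eps in leRHS]splitr EFinD addeA; exact: leeD2r.
Qed.
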